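(* The following optimization problem (regularized A-optimal design, RAOD) is NP-hard: given positive integers $d\le n$ and $k\le n$, vectors $\bm a_1,\dots,\bm a_n\in\mathbb{R}^d$ and a constant $\lambda>0$, solve $$z_k:=\min_{S\subseteq\{1,\dots,n\}}\left\{\operatorname{tr}\left(\left(\sum_{i\in S}\bm a_i\bm a_i^{\top}+\lambda \bm I_d\right)^{-1}\right): |S|=k\right\}.$$
   Context: $\bm I_d$ is the $d\times d$ identity matrix, $\operatorname{tr}$ is the trace, and $|S|$ is the cardinality of $S$. NP-hardness is in the usual sense of computational complexity (an NP-hard decision problem, such as deciding whether a given undirected graph has an independent set of a given size $k$, reduces in polynomial time to it). *)

(* Defs.v *)
From HB Require Import structures.
From mathcomp Require Import all_boot all_order all_algebra.
From mathcomp Require Import reals.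

Set Implicit Arguments.
Unset Strict Implicit.
Unset Printing Implicit Defensive.

Import Order.TTheory GRing.Theory Num.Theory.

Inductive move := MoveLeft | Stay | MoveRight.

(* [None] is the blank, [Some (inl b)] an input/output bit and [Some (inr g)]
   an auxiliary symbol of the machine. *)
Notation cell G := (option (bool + G)%type).

(* A two-way infinite tape: the scanned cell is the head of [tape_right], the
   cells to its left are listed in [tape_left] from the nearest one outwards,
   and every cell that is not listed is blank. *)
Record tape (G : Type) := Tape { tape_left : seq (cell G);
                                 tape_right : seq (cell G) }.

Definition tape_read (G : Type) (t : tape G) : cell G :=
  head None (tape_right t).

Definition tape_act (G : Type) (t : tape G) (a : cell G * move) : tape G :=
  let: Tape l r := t in
  let r' := a.1 :: behead r in
  match a.2 with
  | MoveLeft => Tape (behead l) (head None l :: r')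
  | Stay => Tape l r'
  | MoveRight => Tape (a.1 :: l) (behead r)
  end.

(* [C] is the type of the choices available at each step: a deterministic
   machine is a [tm unit], and a nondeterministic one, given as usual by two
   transition functions, is a [tm bool]. *)
Record tm (C : Type) := TM {
  tm_work : nat;  (* the machine has [tm_work.+1] tapes *)
  tm_aux : finType;
  tm_state : finType;
  tm_start : tm_state;
  tm_halt : pred tm_state;
  tm_accept : pred tm_state;
  tm_delta : C -> tm_state -> {ffun 'I_tm_work.+1 -> cell tm_aux} ->
             tm_state * {ffun 'I_tm_work.+1 -> cell tm_aux * move}
}.

Section Run.
Variables (C : Type) (M : tm C).

Record config := Config {
  conf_state : tm_state M;
  conf_tapes : {ffun 'I_(tm_work M).+1 -> tape (tm_aux M)}
}.

Definition halted (c : config) : bool := tm_halt (conf_state c).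

Definition accepting (c : config) : bool :=
  halted c && tm_accept (conf_state c).

Definition step (c : config) (x : C) : config :=
  if halted c then c else
  let: (q, acts) := tm_delta x (conf_state c)
                      [ffun i => tape_read (conf_tapes c i)] in
  Config q [ffun i => tape_act (conf_tapes c i) (acts i)].

Definition bit_cell (b : bool) : cell (tm_aux M) := Some (inl b).

Definition init (w : seq bool) : config :=
  Config (tm_start M)
    [ffun i => Tape [::] (if i == ord0 then map bit_cell w else [::])].

(* A halted configuration is left unchanged by [step], so that reaching a
   halted one by [run u w] means halting within [size u] steps. *)
Definition run (u : seq C) (w : seq bool) : config := foldl step (init w) u.

(* The output is read on the first tape, from the head to the first blank. *)
Definition has_output (c : config) (v : seq bool) : Prop :=
  exists2 r, tape_right (conf_tapes c ord0) = map bit_cell v ++ r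
           & head None r = None.

End Run.

Definition poly_bound (c n : nat) : nat := c * n ^ c + c.

Definition polytime (f : seq bool -> seq bool) : Prop :=
  exists (M : tm unit) (c : nat), forall w : seq bool,
    let final := run M (nseq (poly_bound c (size w)) tt) w in
    halted final /\ has_output final (f w).

Definition language := seq bool -> Prop.

Definition in_NP (L : language) : Prop :=
  exists (N : tm bool) (c : nat), forall w : seq bool,
    let T := poly_bound c (size w) in
    (forall u : T.-tuple bool, halted (run N u w)) /\
    (L w <-> exists u : T.-tuple bool, accepting (run N u w)).

Definition polytime_reducible (L1 L2 : language) : Prop :=
  exists2 f, polytime f & forall w, L1 w <-> L2 (f w).

Definition NP_hard (L : language) : Prop :=
  forall L', in_NP L' -> polytime_reducible L' L.

Local Open Scope ring_scope.

Section Raod.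
Variables (R : realType) (n d : nat) (a : 'I_n -> 'cV[R]_d) (lambda : R).

Definition raod_obj (S : {set 'I_n}) : R :=
  \tr (invmx (\sum_(i in S) a i *m (a i)^T + lambda%:M)).

(* The set [[set i | i < k]] only provides a feasible point for [arg min]
   when [k <= n]. *)
Definition raod_value (k : nat) : R :=
  raod_obj [arg min_(S < [set i : 'I_n | (i < k)%N] | #|S| == k)
              raod_obj S]%O.

Lemma raod_valueP (k : nat) : (k <= n)%N ->
  (exists2 S : {set 'I_n}, #|S| = k & raod_value k = raod_obj S) /\
  (forall S : {set 'I_n}, #|S| = k -> raod_value k <= raod_obj S).
Proof.
move=> le_kn; rewrite /raod_value; case: arg_minP => [|S /eqP Sk Smin].
  apply/eqP; have -> : [set i : 'I_n | (i < k)%N] = widen_ord le_kn @: setT.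
    apply/setP => i; rewrite inE; apply/idP/imsetP => [lt_ik | [j _ ->]] /=.
      by exists (Ordinal lt_ik) => //; apply/val_inj.
    exact: ltn_ord.
  rewrite card_imset ?cardsT ?card_ord // => i j /(congr1 val) /= eq_ij.
  exact/val_inj.
by split=> [|S' /eqP]; [exists S | exact: Smin].
Qed.

End Raod.

(* Least significant bit first, without leading zeros. *)
Definition nat_bits (n : nat) : seq bool :=
  [seq odd (n %/ 2 ^ i) | i <- iota 0 (up_log 2 n.+1)].

(* Each bit is preceded by [true] and the end is marked by [false], which makes
   the code prefix-free. *)
Definition enc_nat (n : nat) : seq bool :=
  flatten [seq [:: true; b] | b <- nat_bits n] ++ [:: false].

Definition enc_int (z : int) : seq bool := (z < 0) :: enc_nat `|z|.

Definition enc_rat (q : rat) : seq bool := enc_int (numq q) ++ enc_int (denq q).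

(* An instance of the optimization problem, together with the threshold that
   turns it into a decision problem. *)
Record raod_instance := RaodInstance {
  raod_n : nat;
  raod_d : nat;
  raod_k : nat;
  raod_lambda : rat;
  raod_threshold : rat;
  raod_vec : {ffun 'I_raod_n -> 'cV[rat]_raod_d}
}.

Definition raod_valid (I : raod_instance) : Prop :=
  [/\ (0 < raod_d I <= raod_n I)%N, (0 < raod_k I <= raod_n I)%N
    & 0 < raod_lambda I].

Definition enc_raod (I : raod_instance) : seq bool :=
  enc_nat (raod_n I) ++ enc_nat (raod_d I) ++ enc_nat (raod_k I) ++
  enc_rat (raod_lambda I) ++ enc_rat (raod_threshold I) ++
  flatten [seq enc_rat (raod_vec I i j 0)
             | i <- enum 'I_(raod_n I), j <- enum 'I_(raod_d I)].

(* The decision problem of the minimization problem: is the minimum at most the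
   given threshold? *)
Definition RAOD (R : realType) : language := fun w =>
  exists I : raod_instance,
    [/\ raod_valid I, w = enc_raod I
      & raod_value (fun i => map_mx ratr (raod_vec I i) : 'cV[R]_(raod_d I))
          (ratr (raod_lambda I)) (raod_k I)
        <= ratr (raod_threshold I)].

Lemma nat_bits_inj : injective nat_bits.
Proof.
have expand n k : (n < 2 ^ k)%N ->
    (n = \sum_(i < k) odd (n %/ 2 ^ i) * 2 ^ i)%N.
  elim: k n => [|k IHk] n lt_n.
    by rewrite big_ord0; case: n lt_n.
  rewrite big_ord_recl expn0 divn1 muln1.
  have lt2 : (n %/ 2 < 2 ^ k)%N by rewrite ltn_divLR // mulnC -expnS.
  have -> : (\sum_(i < k) odd (n %/ 2 ^ lift ord0 i) * 2 ^ lift ord0 i =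
             (\sum_(i < k) odd (n %/ 2 %/ 2 ^ i) * 2 ^ i) * 2)%N.
    rewrite big_distrl /=; apply: eq_bigr => i _.
    by rewrite /bump /= add1n expnS divnMA -mulnA (mulnC (2 ^ i)%N).
  by rewrite -IHk // {1}(divn_eq n 2) modn2 addnC.
move=> m n eq_mn; have := congr1 size eq_mn; rewrite !size_map !size_iota => eqk.
have ltm : (m < 2 ^ up_log 2 m.+1)%N by exact: up_logP.
have ltn' : (n < 2 ^ up_log 2 n.+1)%N by exact: up_logP.
rewrite (expand _ _ ltm) (expand _ _ ltn') -eqk; apply: eq_bigr => i _.
have lt_i : (i < up_log 2 n.+1)%N by rewrite -eqk.
have := congr1 (fun s => nth false s i) eq_mn.
rewrite /nat_bits !(nth_map 0%N) ?size_iota // !nth_iota //.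
by rewrite !add0n => ->.
Qed.

Lemma enc_nat_prefix m n s t :
  enc_nat m ++ s = enc_nat n ++ t -> m = n /\ s = t.
Proof.
rewrite /enc_nat -!catA /=.
suff H (u v : seq bool) : flatten [seq [:: true; b] | b <- u] ++ false :: s =
    flatten [seq [:: true; b] | b <- v] ++ false :: t -> u = v /\ s = t.
  by case/H => /nat_bits_inj -> ->.
elim: u v => [|b u IHu] [|c v] //= [] => [-> //| -> /IHu [-> ->] //].
Qed.

Lemma enc_int_prefix y z s t :
  enc_int y ++ s = enc_int z ++ t -> y = z /\ s = t.
Proof.
rewrite /enc_int /= => -[eq_lt /enc_nat_prefix [eq_abs ->]]; split=> //.
by rewrite [y]intEsign [z]intEsign eq_lt eq_abs.
Qed.

Lemma enc_rat_prefix p q s t :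
  enc_rat p ++ s = enc_rat q ++ t -> p = q /\ s = t.
Proof.
rewrite /enc_rat -!catA => /enc_int_prefix [eqn /enc_int_prefix [eqd ->]].
by split=> //; rewrite -[p]divq_num_den -[q]divq_num_den eqn eqd.
Qed.

Lemma enc_raod_inj : injective enc_raod.
Proof.
case=> n d k l t a [n' d' k' l' t' a']; rewrite /enc_raod /=.
case/enc_nat_prefix => ? /enc_nat_prefix [? /enc_nat_prefix [?]]; subst n' d' k'.
case/enc_rat_prefix => ? /enc_rat_prefix [?]; subst l' t' => eqf.
suff -> : a = a' by [].
have flat_inj (T : eqType) (f g : T -> rat) (r : seq T) :
    flatten [seq enc_rat (f x) | x <- r] = flatten [seq enc_rat (g x) | x <- r]
    -> {in r, f =1 g}.
  elim: r => [|x r IHr] //= /enc_rat_prefix [eqx /IHr eqr] y.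
  by rewrite inE => /predU1P [->|/eqr].
apply/ffunP => i; apply/matrixP => j j0; rewrite ord1 {j0}.
set r := [seq (i, j) | i <- enum 'I_n, j <- enum 'I_d].
have pairsE (b : {ffun 'I_n -> 'cV[rat]_d}) :
    [seq enc_rat (b i j 0) | i <- enum 'I_n, j <- enum 'I_d] =
    [seq enc_rat (b x.1 x.2 0) | x <- r] by rewrite map_allpairs.
rewrite !pairsE in eqf.
apply: (flat_inj _ (fun x => a x.1 x.2 0) (fun x => a' x.1 x.2 0) _ eqf (i, j)).
by apply/allpairsP; exists (i, j); rewrite /= !mem_enum.
Qed.

(* Main.v *)
From mathcomp Require Import all_boot all_order all_algebra.
From mathcomp Require Import boolp reals ring lra zify.
Require Import Defs.

(* By Sylvester's identity the objective equals (d - k)/lambda plus the trace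
   of the inverse of the regularized Gram matrix of the selected vectors.  When
   all squared norms are at most 1 - lambda, convexity of the trace of the
   inverse shows that it is at least (d - k)/lambda + k, with equality exactly
   when the selected vectors are pairwise orthogonal of squared norm
   1 - lambda.  Taking lambda = 1/2, it is thus NP-hard to find k such pairwise
   orthogonal vectors.

   The accepting runs of a nondeterministic machine are the labellings of a
   time x space grid, each site being labelled by a window of bounded size, that
   satisfy a local condition at each site and agree along the links between
   neighbouring sites.  Each site contributes one vector per label, with equal
   entries on its support, so that vectors of one site overlap and vectors of
   linked sites are orthogonal exactly when their labels agree; k is the number
   of sites.  The nonzero blocks of a vector are at a fixed distance from each
   other, so the matrix is written out by loops over unary counters. *)

Set Implicit Arguments.
Unset Strict Implicit.
Unset Printing Implicit Defensive.

Import Order.TTheory GRing.Theory Num.Theory.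

(** * Optimality of orthogonal designs *)

(** [NP_hard] ranges over all languages in NP, so the reduction starts from an arbitrary
    nondeterministic machine and passes through no intermediate problem. Several heads threaten
    locality, since an action depends on cells at unrelated positions. Cutting each tape at its head
    puts all scanned cells at position 0; a step then shifts the tapes by at most one cell, which a
    window of three slices can check. Rows end at position [L], where wrong symbols may enter, but
    these travel one cell per step and come too late to influence the final state. The instance has
    to be rational: [m] entries equal to [1 / q] have squared norm 1/2 when [q ^ 2 = 2 m], which
    [q = 2 h], [m = 2 h ^ 2] solves for every [h > 0]. As no entry is negative, orthogonality
    becomes disjointness of supports, a combinatorial condition on rows of bits. *)

Section OrthogonalDesigns.
Local Open Scope ring_scope.
Variables (R : realType) (n d : nat) (a : 'I_n -> 'cV[R]_d) (lambda : R).
Hypothesis lambda_gt0 : 0 < lambda.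
Variable S : {set 'I_n}.

Definition dotc (u v : 'cV[R]_d) : R := \sum_j u j 0 * v j 0.

(** Columns outside [S] are set to zero rather than removed, so that the Gram matrix has the fixed
    size [n]; each such index contributes [1 / lambda] to the trace of its inverse. *)
Definition design_mx : 'M[R]_(d, n) :=
  \matrix_(j, i) (if i \in S then a i j 0 else 0).

Definition info_mx : 'M[R]_d := design_mx *m design_mx^T + lambda%:M.

Definition gram_mx : 'M[R]_n := design_mx^T *m design_mx + lambda%:M.

Lemma info_mxE : \sum_(i in S) a i *m (a i)^T + lambda%:M = info_mx.
Proof.
congr (_ + _); apply/matrixP => i j; rewrite summxE mxE big_mkcond /=.
apply: eq_bigr => l _; rewrite !mxE; case: ifP => _; last by rewrite mul0r.
by rewrite big_ord1 !mxE.
Qed.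

Lemma gram_mxE i j : gram_mx i j =
  (if (i \in S) && (j \in S) then dotc (a i) (a j) else 0) + lambda *+ (i == j).
Proof.
rewrite !mxE; congr (_ + _); case: ifP => [/andP[iS jS] | niS].
  by apply: eq_bigr => l _; rewrite !mxE iS jS.
apply: big1 => l _; rewrite !mxE.
by move: niS; case: (i \in S); case: (j \in S) => //= _; rewrite ?mul0r ?mulr0.
Qed.

(** With [U] the design matrix, the remaining part of the form is the squared norm of [y U^T]. The
    bound makes the Gram matrix invertible and later controls how far its inverse is from the
    optimal one. *)
Lemma gram_form (y : 'rV[R]_n) :
  lambda * (\sum_i y 0 i ^+ 2) <= (y *m gram_mx *m y^T) 0 0.
Proof.
have sqE m (z : 'rV[R]_m) : (z *m z^T) 0 0 = \sum_i z 0 i ^+ 2.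
  by rewrite mxE; apply: eq_bigr => i _; rewrite mxE expr2.
have -> : y *m gram_mx *m y^T =
    (y *m design_mx^T) *m (y *m design_mx^T)^T + lambda *: (y *m y^T).
  by rewrite mulmxDr mulmxDl mul_mx_scalar -scalemxAl trmx_mul trmxK !mulmxA.
set z := y *m design_mx^T.
have -> : (z *m z^T + lambda *: (y *m y^T)) 0 0 =
    (z *m z^T) 0 0 + lambda * (y *m y^T) 0 0 by rewrite mxE [X in _ + X]mxE.
rewrite !sqE lerDr sumr_ge0 // => i _; exact: sqr_ge0.
Qed.

Lemma gram_unit : gram_mx \in unitmx.
Proof.
rewrite -row_free_unit; apply/inj_row_free => y yK0.
have := gram_form y; rewrite yK0 mul0mx mxE pmulr_rle0 // => le0.
have y2_ge0 i : 0 <= y 0 i ^+ 2 by exact: sqr_ge0.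
apply/rowP => i; rewrite mxE; apply/eqP; rewrite -sqrf_eq0 eq_le y2_ge0 andbT.
apply: le_trans le0; rewrite (bigD1 i) //= lerDl; exact: sumr_ge0.
Qed.

Lemma gram_sym : gram_mx^T = gram_mx.
Proof. by rewrite linearD /= trmx_mul trmxK tr_scalar_mx. Qed.

(** With [K] the Gram matrix, [info_mx U = U K] shows that [info_mx] has inverse
    [lambda^-1 (1 - U K^-1 U^T)]; in its trace, [U^T U = K - lambda]. *)
Lemma raod_obj_gram :
  raod_obj a lambda S = (d%:R - n%:R) / lambda + \tr (invmx gram_mx).
Proof.
rewrite /raod_obj info_mxE.
have lam0 : lambda != 0 by rewrite gt_eqF.
pose U := design_mx.
have PU : info_mx *m U = U *m gram_mx.
  by rewrite mulmxDl mulmxDr -mulmxA mul_scalar_mx mul_mx_scalar.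
pose Q := lambda^-1 *: (1%:M - U *m invmx gram_mx *m U^T).
have PQ : info_mx *m Q = 1%:M.
  rewrite /Q -scalemxAr mulmxBr mulmx1 !mulmxA PU -(mulmxA U) mulmxV
      ?gram_unit //.
  by rewrite mulmx1 /info_mx [X in X - _]addrC addrK -[lambda%:M]scalemx1
      scalerA mulVf // scale1r.
have uP : info_mx \in unitmx by case/mulmx1_unit: PQ.
have -> : invmx info_mx = Q by rewrite -[RHS](mulKmx uP) PQ mulmx1.
rewrite /Q mxtraceZ linearB /= mxtrace1 mxtrace_mulC mulmxA.
have -> : U^T *m U = gram_mx - lambda%:M by rewrite /gram_mx addrK.
rewrite mulmxBl mulmxV ?gram_unit // mul_scalar_mx linearB /= mxtrace1 mxtraceZ.
by field.
Qed.

Lemma natr_setC : #|[pred i | i \notin S]|%:R = n%:R - #|S|%:R :> R.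
Proof.
have cardS : (#|S| + #|[pred i | i \notin S]| = n)%N.
  by rewrite -[RHS]card_ord -(cardC (mem S)); congr (_ + _)%N; apply: eq_card.
by rewrite -[n%:R in RHS](congr1 (fun m => m%:R) cardS) natrD addrC addKr.
Qed.

(** The Gram matrix is then diagonal, with entries 1 on [S] and [lambda] elsewhere. *)
Lemma raod_obj_orthogonal :
  (forall i, i \in S -> dotc (a i) (a i) = 1 - lambda) ->
  (forall i j, i \in S -> j \in S -> i != j -> dotc (a i) (a j) = 0) ->
  raod_obj a lambda S = (d%:R - #|S|%:R) / lambda + #|S|%:R.
Proof.
move=> norm orth; rewrite raod_obj_gram.
have lam0 : lambda != 0 by rewrite gt_eqF.
pose f i : R := if i \in S then 1 else lambda^-1.
have KF : gram_mx *m diag_mx (\row_i f i) = 1%:M.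
  apply/matrixP => i j; rewrite mul_mx_diag [LHS]mxE gram_mxE !mxE /f.
  have [<-|ij] := eqVneq i j.
    rewrite andbb !mulr1n; case: ifP => iS; last by rewrite add0r divff.
    by rewrite norm // subrK mulr1.
  rewrite addr0; case: ifP => [/andP[iS jS]|]; last by rewrite mul0r.
  by rewrite orth // mul0r.
have -> : invmx gram_mx = diag_mx (\row_i f i).
  by rewrite -[RHS](mulKmx gram_unit) KF mulmx1.
rewrite mxtrace_diag (bigID (mem S)) /=.
rewrite (eq_bigr (fun=> 1)) => [|i iS]; last by rewrite mxE /f iS.
rewrite [X in _ + (_ + X)](eq_bigr (fun=> lambda^-1)) => [|i /negbTE iS];
  last by rewrite mxE /f iS.
rewrite !sumr_const -[lambda^-1 *+ _]mulr_natr natr_setC; by field.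
Qed.

(* [K^-1 - 2 F + F K F = (K^-1 - F) K (K^-1 - F)] for the Gram matrix [K] and
   the value [F] of its inverse at an orthogonal design: this is the convexity
   of the trace of the inverse, and the right-hand side vanishes only at
   [K^-1 = F]. *)
Lemma raod_obj_le_orthogonal :
  (forall i, dotc (a i) (a i) <= 1 - lambda) ->
  raod_obj a lambda S <= (d%:R - #|S|%:R) / lambda + #|S|%:R ->
  (forall i, i \in S -> dotc (a i) (a i) = 1 - lambda) /\
  (forall i j, i \in S -> j \in S -> i != j -> dotc (a i) (a j) = 0).
Proof.
move=> norm; rewrite raod_obj_gram.
have lam0 : lambda != 0 by rewrite gt_eqF.
pose f i : R := if i \in S then 1 else lambda^-1.
pose F := diag_mx (\row_i f i).
pose K := gram_mx; pose Y := invmx K - F.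
have uK : K \in unitmx by exact: gram_unit.
have YKY : \tr (Y *m K *m Y^T) =
    \tr (invmx K) - \sum_i (2 * f i - f i ^+ 2 * K i i).
  have -> : Y^T = Y by rewrite linearB /= trmx_inv gram_sym tr_diag_mx.
  have -> : Y *m K *m Y = invmx K - F - (F - F *m K *m F).
    rewrite mulmxBl mulVmx // mulmxBr !(mulmxBl 1%:M) !mul1mx.
    by rewrite -[F *m K *m invmx K]mulmxA mulmxV // mulmx1.
  rewrite !raddfB /=.
  have -> : \tr (F *m K *m F) = \sum_i f i ^+ 2 * K i i.
    by apply: eq_bigr => i _; rewrite mul_mx_diag mxE mul_diag_mx !mxE; ring.
  have -> : \tr F = \sum_i f i.
    by rewrite mxtrace_diag; apply: eq_bigr => i _; rewrite mxE.
  rewrite sumrB -mulr_sumr; ring.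
have Y2_ge0 i : 0 <= \sum_j Y i j ^+ 2
  by apply: sumr_ge0 => j _; exact: sqr_ge0.
have YKY_ge : lambda * (\sum_i \sum_j Y i j ^+ 2) <= \tr (Y *m K *m Y^T).
  rewrite mulr_sumr; apply: ler_sum => i _.
  have := gram_form (row i Y).
  under eq_bigr => j _ do rewrite mxE.
  move=> /le_trans -> //; rewrite -row_mul mxE [leRHS]mxE.
  by apply: ler_sum => j _; rewrite !mxE.
rewrite YKY in YKY_ge => obj_le.
have sumf : \sum_i (2 * f i - f i ^+ 2 * K i i) =
    \sum_(i in S) (2 - K i i) + (n%:R - #|S|%:R) / lambda.
  rewrite (bigID (mem S)) /=; congr (_ + _).
    by apply: eq_bigr => i iS; rewrite /f iS; ring.
  rewrite (eq_bigr (fun=> lambda^-1)) => [|i /negbTE niS].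
    by rewrite sumr_const -natr_setC -[lambda^-1 *+ _]mulr_natr mulrC.
  by rewrite gram_mxE /f niS /= eqxx mulr1n; field.
(* Both summands are nonnegative, the first because all squared norms are at most [1 - lambda]. So
   both vanish: the first yields the norms, and [Y = 0] the orthogonality. *)
have : \sum_(i in S) (1 - K i i) + lambda * (\sum_i \sum_j Y i j ^+ 2) <= 0.
  have -> : \sum_(i in S) (1 - K i i) = \sum_(i in S) (2 - K i i) - #|S|%:R.
    by rewrite -sumr_const -sumrB; apply: eq_bigr => i _; ring.
  move: YKY_ge obj_le; rewrite sumf; lra.
have Kii i : i \in S -> K i i = dotc (a i) (a i) + lambda.
  by move=> iS; rewrite gram_mxE iS eqxx mulr1n.
have K1_ge0 i : i \in S -> 0 <= 1 - K i i.
  by move=> iS; rewrite Kii //; have := norm i; lra.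
move=> le0.
have sumK0 : \sum_(i in S) (1 - K i i) = 0.
  apply/eqP; rewrite eq_le sumr_ge0 // andbT; apply: le_trans le0.
  rewrite lerDl; apply: mulr_ge0; first exact: ltW.
  by apply: sumr_ge0 => i _.
have Y0 : Y = 0.
  have Ysum0 : \sum_i \sum_j Y i j ^+ 2 = 0.
    apply: le_anti; move: le0; rewrite sumK0 add0r pmulr_rle0 // => -> /=.
    by apply: sumr_ge0 => i _.
  apply/matrixP => i j; rewrite [RHS]mxE; apply/eqP; rewrite -sqrf_eq0.
  move/psumr_eq0P: Ysum0 => /(_ (fun i _ => Y2_ge0 i) i isT).
  by move/psumr_eq0P => -> // k _; exact: sqr_ge0.
have normS i : i \in S -> dotc (a i) (a i) = 1 - lambda.
  move=> iS; move/psumr_eq0P: sumK0 => /(_ K1_ge0 i iS); rewrite Kii //; lra.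
split=> // i j iS jS ij.
have : F *m K = 1%:M.
  by rewrite (_ : F = invmx K) ?mulVmx // -[RHS](subrK F) -/Y Y0 add0r.
move/matrixP/(_ i j); rewrite mul_diag_mx [LHS]mxE gram_mxE !mxE iS jS /= /f iS.
by rewrite (negbTE ij) addr0 mul1r.
Qed.
End OrthogonalDesigns.

(** * Tableaux of a nondeterministic machine *)

Section Tableau.
Variable N : tm bool.
Local Notation tapes := 'I_(tm_work N).+1.
Local Notation ncell := (cell (tm_aux N)).

Definition action : finType := (tm_state N * bool * {ffun tapes -> ncell})%type.

(* The tapes folded at the head: the cells at distance [p] from the head, to
   the left and to the right of it (the scanned cell being at [0] on the
   right). *)
Definition slice : finType := {ffun tapes -> ncell * ncell}.

(* The action of step [t], the slice at [p] before the action, and the slices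
   at [p - 1], [p], [p + 1] once the action has written its symbols but not yet
   moved the heads. *)
Definition window : finType := (action * slice * (slice * slice * slice))%type.

Definition w_action (v : window) : action := v.1.1.
Definition w_cur (v : window) : slice := v.1.2.
Definition w_prev (v : window) : slice := v.2.1.1.
Definition w_mid (v : window) : slice := v.2.1.2.
Definition w_next (v : window) : slice := v.2.2.

(** A halting state acts by rewriting what it reads without moving, so that the tableau can continue
    to a fixed last row after the machine has halted. *)
Definition effect (a : action) : tm_state N * {ffun tapes -> ncell * move} :=
  if tm_halt a.1.1 then (a.1.1, [ffun i => (a.2 i, Stay)])
  else tm_delta a.1.2 a.1.1 a.2.

Definition written (a : action) (x : slice) : slice :=
  [ffun i => ((x i).1, ((effect a).2 i).1)].

Definition swap_slice (y : slice) : slice := [ffun i => ((y i).2, (y i).1)].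

(** When a head moves left, the left half of its tape comes one cell closer and the right half
    recedes by one. At distance 0 the receding half takes its new cell from the other half, through
    the swapped slice at distance -1. *)
Definition shifted (a : action) (prev mid next : slice) : slice :=
  [ffun i => match ((effect a).2 i).2 with
    | MoveLeft => ((next i).1, (prev i).2)
    | Stay => mid i
    | MoveRight => ((prev i).1, (next i).2)
    end].

Definition input_slice (x : option bool) : slice :=
  [ffun i => (None, if i == ord0 then omap inl x else None)].

Record flags := Flags {
  is_first : bool; is_last : bool; is_edge : bool; input_bit : option bool }.

(* The folding makes [swap_slice (w_mid v)] the slice at distance [-1]. *)
Definition local_ok (fl : flags) (v : window) : bool :=
  [&& (if is_edge fl then
        [&& w_prev v == swap_slice (w_mid v),
            w_mid v == written (w_action v) (w_cur v)
          & (w_action v).2 == [ffun i => (w_cur v i).2]]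
       else w_mid v == w_cur v),
      is_first fl ==> ((w_action v).1.1 == tm_start N) &&
                      (w_cur v == input_slice (input_bit fl))
    & is_last fl ==> tm_halt (w_action v).1.1 && tm_accept (w_action v).1.1].

(** Repeating the action in the horizontal link makes a whole row follow the same head moves,
    although only the site at the edge sees the scanned symbols. *)
Definition hlink : finType := (action * slice * slice)%type.
Definition vlink : finType := (tm_state N * slice)%type.

Definition link_left (v : window) : hlink := (w_action v, w_prev v, w_mid v).
Definition link_right (v : window) : hlink := (w_action v, w_mid v, w_next v).
Definition link_up (v : window) : vlink := ((w_action v).1.1, w_cur v).
Definition link_down (v : window) : vlink :=
  ((effect (w_action v)).1,
   shifted (w_action v) (w_prev v) (w_mid v) (w_next v)).

(** With the input bit cleared after time 0, the later rows have flags that do not mention the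
    input, and the program writes them by plain repetition. *)
Definition flags_at (w : seq bool) (L t p : nat) : flags :=
  Flags (t == 0) (t == L.+1) (p == 0)
        (if t == 0 then nth None (map Some w) p else None).

Definition tableau (w : seq bool) (L : nat) (v : nat -> nat -> window) : Prop :=
  [/\ forall t p, t <= L.+1 -> p <= L -> local_ok (flags_at w L t p) (v t p),
      forall t p, t <= L.+1 -> p < L ->
        link_right (v t p) = link_left (v t p.+1)
    & forall t p, t <= L -> p <= L -> link_down (v t p) = link_up (v t.+1 p)].

Definition slice_of (c : config N) (p : nat) : slice :=
  [ffun i => (nth None (tape_left (conf_tapes c i)) p,
              nth None (tape_right (conf_tapes c i)) p)].

Definition action_of (c : config N) (b : bool) : action :=
  (conf_state c, b, [ffun i => tape_read (conf_tapes c i)]).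

Definition mid_of c b p : slice :=
  if p == 0 then written (action_of c b) (slice_of c 0) else slice_of c p.

Definition prev_of c b p : slice :=
  if p is p'.+1 then mid_of c b p' else swap_slice (mid_of c b 0).

Lemma step_state c b : conf_state (step c b) = (effect (action_of c b)).1.
Proof.
rewrite /step /effect /action_of /halted /=; case: ifP => // _.
by case: tm_delta.
Qed.

Lemma step_slice c b p :
  slice_of (step c b) p =
    shifted (action_of c b) (prev_of c b p) (mid_of c b p) (mid_of c b p.+1).
Proof.
apply/ffunP => i.
have actE : effect (action_of c b) =
    if tm_halt (conf_state c)
    then (conf_state c, [ffun i => (tape_read (conf_tapes c i), Stay)])
    else tm_delta b (conf_state c) [ffun i => tape_read (conf_tapes c i)].
  rewrite /effect /action_of /=; case: ifP => // _; congr (_, _).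
  by apply/ffunP => j; rewrite !ffunE.
rewrite !ffunE /mid_of /prev_of /mid_of /written actE /step /halted.
case: (tm_halt _) => /=.
  by rewrite !ffunE /=; case: p => [|p] //=; rewrite !ffunE.
case: (tm_delta _ _ _) => [q acts] /=; rewrite ffunE.
case ai: (acts i) => [wr []] /=; case: p => [|[|p]] //=;
  rewrite !ffunE; case: (conf_tapes c i) => l r /=;
  rewrite ?ai //= -?nth0 ?nth_behead //= ?ai.
Qed.

Lemma slice_of_reads c :
  [ffun i => (slice_of c 0 i).2] = [ffun i => tape_read (conf_tapes c i)].
Proof. by apply/ffunP => i; rewrite !ffunE /= nth0. Qed.

Lemma slice_of_init w p :
  slice_of (init N w) p = input_slice (nth None (map Some w) p).
Proof.
apply/ffunP => i; rewrite !ffunE /= nth_nil; case: eqP => _;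
    last by rewrite nth_nil.
congr (_, _); have [lt|le] := ltnP p (size w).
  by rewrite !(nth_map false).
by rewrite !nth_default ?size_map.
Qed.

Lemma run_rcons u b w : run N (rcons u b) w = step (run N u w) b.
Proof. by rewrite /run foldl_rcons. Qed.

Lemma run_cat_halted u u' w :
  halted (run N u w) -> run N (u ++ u') w = run N u w.
Proof.
move=> hu; elim/last_ind: u' => [|u' b IH]; first by rewrite cats0.
by rewrite -rcons_cat run_rcons IH /step hu.
Qed.

Lemma tableau_sound w L v : tableau w L v ->
  exists2 u : seq bool, size u = L.+1 & accepting (run N u w).
Proof.
case=> okv hv vv; pose b t := (w_action (v t 0)).1.2.
pose conf t := run N (mkseq b t) w.
have confS t : conf t.+1 = step (conf t) (b t).
  by rewrite /conf /mkseq -addn1 iotaD map_cat cats1 run_rcons.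
have act0 t p : t <= L.+1 -> p <= L -> w_action (v t p) = w_action (v t 0).
  move=> let_; elim: p => // p IH lep; rewrite -IH 1?ltnW //.
  by have := hv t p let_ lep; case.
(* Nothing checks [w_next] at position [L], so each row guarantees one cell less than the one
   before. Position 0 stays correct up to time [L], which still determines the state at time [L.+1],
   where acceptance is tested. *)
have H t : t <= L.+1 -> (w_action (v t 0)).1.1 = conf_state (conf t) /\
    (forall p, p + t <= L -> w_cur (v t p) = slice_of (conf t) p).
  elim: t => [_|t IH let_].
    split=> [|p]; first by have /and3P[_ /andP[/eqP -> _] _] := okv 0 0 isT isT.
    rewrite addn0 => lep; have /and3P[_ /andP[_ /eqP -> ] _] := okv 0 p isT lep.
    by rewrite slice_of_init.
  have [st cur] := IH (ltnW let_).
  have cur0 : w_cur (v t 0) = slice_of (conf t) 0 by exact: cur.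
  have /and3P[/= /and3P[/eqP prev0 /eqP mid0 /eqP rd0] _ _] :=
    okv t 0 (ltnW let_) isT.
  have actE : w_action (v t 0) = action_of (conf t) (b t).
    rewrite /action_of -st -slice_of_reads -cur0 -rd0 /b.
    by case: (w_action _) => [[]].
  have midE p : p + t <= L -> w_mid (v t p) = mid_of (conf t) (b t) p.
    move=> lep; rewrite /mid_of; case: p lep => [_|p lep] /=.
      by rewrite mid0 actE cur0.
    rewrite -cur //; have lep' : p.+1 <= L by lia.
    by have /and3P[/eqP] := okv t p.+1 (ltnW let_) lep'.
  have prevE p : p + t <= L -> w_prev (v t p) = prev_of (conf t) (b t) p.
    case: p => [lep|p lep] /=; first by rewrite prev0 midE.
    rewrite -midE; last by lia.
    have lep' : p < L by lia.
    by have := hv t p (ltnW let_) lep'; case.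
  have nextE p : p + t < L -> w_next (v t p) = mid_of (conf t) (b t) p.+1.
    move=> lep; rewrite -midE ?addSn //.
    have lep' : p < L by lia.
    by have := hv t p (ltnW let_) lep'; case.
  split.
    have := vv t 0 let_ isT; case=> <- _.
    by rewrite confS step_state actE.
  move=> p lep; have lep' : p <= L by lia.
  have := vv t p let_ lep'; case=> _ <-.
  rewrite confS step_slice prevE ?midE ?nextE; try lia.
  by rewrite (act0 t p) ?actE // ltnW.
exists (mkseq b L.+1); first by rewrite size_mkseq.
have [st _] := H L.+1 (leqnn _).
rewrite /accepting /halted -/(conf L.+1) -st.
by have /and3P[_ _] := okv L.+1 0 (leqnn _) isT; rewrite /= eqxx.
Qed.

Lemma tableau_complete w L (u : seq bool) :
  size u = L.+1 -> accepting (run N u w) -> exists v, tableau w L v.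
Proof.
(* The choices end before row [L.+1], whose action takes the default [false]; no row follows it. *)
move=> szu acc; pose b t := nth false u t.
pose conf t := run N (take t u) w.
have confS t : t <= L -> conf t.+1 = step (conf t) (b t).
  by move=> let_; rewrite /conf (take_nth false) ?szu // run_rcons.
exists (fun t p => (action_of (conf t) (b t), slice_of (conf t) p,
  (prev_of (conf t) (b t) p, mid_of (conf t) (b t) p, mid_of (conf t) (b t)
      p.+1))).
split=> [t p let_ lep|t p let_ ltp|t p let_ lep].
- apply/and3P; split=> /=; first case: eqP => [->|/eqP/negbTE p0].
  + by rewrite !eqxx /w_action /w_cur /= slice_of_reads.
  + by rewrite /w_mid /w_cur /= /mid_of p0.
  + apply/implyP => /eqP ->; rewrite /w_action /w_cur /= /conf take0 eqxx.
    by rewrite slice_of_init /= eqxx.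
  apply/implyP => /eqP ->; rewrite /w_action /= /conf take_oversize ?szu //.
- by [].
by rewrite /link_down /link_up /w_action /w_cur /= confS // step_state
    step_slice.
Qed.

(** All runs have halted after [T] steps, and a halted configuration is frozen: padding the choices
    to length [L.+1] or truncating them to length [T] changes nothing. *)
Lemma accepting_tableau w T L :
  (forall u : T.-tuple bool, halted (run N u w)) -> T <= L ->
  (exists u : T.-tuple bool, accepting (run N u w)) <-> exists v, tableau w L v.
Proof.
move=> hlt leTL; split=> [[u acc]|[v /tableau_sound[u szu acc]]].
  apply: (@tableau_complete w L (u ++ nseq (L.+1 - T) false)).
    by rewrite size_cat size_tuple size_nseq subnKC // ltnW.
  by rewrite run_cat_halted.
have szt : size (take T u) == T by rewrite size_takel ?szu // ltnW.
exists (Tuple szt); move: (hlt (Tuple szt)) => /= ht.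
by rewrite -(run_cat_halted (drop T u)) // cat_take_drop.
Qed.
End Tableau.

(** * From tableaux to orthogonal vectors *)

Lemma nth_flatten_blocks (T : Type) (x0 : T) m (ss : seq (seq T)) b j :
  all (fun s => size s == m) ss -> j < m ->
  nth x0 (flatten ss) (b * m + j) = nth x0 (nth [::] ss b) j.
Proof.
move=> + ltj; elim: ss b => [|s ss IH] b /=; first by rewrite !nth_nil.
case/andP => /eqP szs /IH {}IH; rewrite nth_cat szs; case: b => [|b] /=.
  by rewrite mul0n add0n ltj.
rewrite mulSn -addnA ltnNge leq_addr /= addKn; exact: IH.
Qed.

Lemma size_flatten_blocks (T : Type) m (ss : seq (seq T)) :
  all (fun s => size s == m) ss -> size (flatten ss) = size ss * m.
Proof.
by elim: ss => //= s ss IH /andP[/eqP szs /IH {}IH];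
    rewrite size_cat szs IH mulSn.
Qed.

Lemma count_enum (T : finType) (f : T -> bool) : count f (enum T) = \sum_x f x.
Proof.
rewrite -sum1_count big_mkcond [LHS]big_enum /=.
by apply: eq_bigr => x _; case: (f x).
Qed.

Section Rows.
Variables (N : tm bool) (w : seq bool) (L : nat).
Local Notation hlink := (hlink N).
Local Notation vlink := (vlink N).
Local Notation window := (window N).

(* The nonzero entries of a vector are [1 / (2 * half_scale)], and [pad] brings
   their number to [2 * half_scale ^ 2], that is, the squared norm to [1/2]. *)
Definition half_scale : nat := #|hlink| + #|vlink|.

Definition pad : nat := 2 * half_scale ^ 2 - half_scale.

(* The coordinates attached to a site: one for each value of the link with the
   previous site of the row and of the link with the next time, and those that
   adjust the norms and make the vectors of one site overlap. *)
Definition slot : finType := (hlink + vlink + (unit + 'I_pad))%type.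

(* Of two linked sites, one has entry 1 at the value of the link and the other
   one at all its other values: they are orthogonal exactly when the values
   agree. *)
Definition own_bit (fl : flags) (v : window) (c : slot) : bool :=
  local_ok fl v && match c with
  | inl (inl h) => ~~ is_edge fl && (link_left v == h)
  | inl (inr z) => link_down v == z
  | inr (inl _) => is_edge fl
  | inr (inr _) => true
  end.

Definition right_bit (fl : flags) (v : window) (c : slot) : bool :=
  local_ok fl v && if c is inl (inl h) then link_right v != h else false.

Definition up_bit (fl : flags) (v : window) (c : slot) : bool :=
  local_ok fl v && if c is inl (inr z) then link_up v != z else false.

Definition block (f : slot -> bool) : seq bool := map f (enum slot).

Definition zero_block : seq bool := nseq #|slot| false.

(* The site at time [t] and position [p] has number [t * L.+1 + p]. *)
Definition sites : nat := L.+2 * L.+1.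

(* Block [b] belongs to site [b - L.+1], and to no site if [b < L.+1]; the row
   of site [s] meets the blocks of the sites [s - L.+1], [s] and [s + 1]. *)
Definition row_blocks (s : nat) (fl : flags) (v : window) : seq (seq bool) :=
  nseq s zero_block ++ block (up_bit fl v) :: nseq L zero_block ++
  [:: block (own_bit fl v), block (right_bit fl v)
    & nseq (sites - s.+1) zero_block].

Definition row s fl v : seq bool := flatten (row_blocks s fl v).

Lemma size_block f : size (block f) = #|slot|.
Proof. by rewrite size_map -cardE. Qed.

Lemma row_blocks_size s fl v :
  all (fun r => size r == #|slot|) (row_blocks s fl v).
Proof.
rewrite all_cat /= all_cat /= !size_block eqxx !all_nseq size_nseq eqxx.
by rewrite !orbT.
Qed.

Lemma size_row s fl v :
  s < sites -> size (row s fl v) = (sites + L + 2) * #|slot|.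
Proof.
move=> lts; rewrite (size_flatten_blocks (row_blocks_size _ _ _));
    congr (_ * _).
rewrite size_cat /= size_cat /= !size_nseq; lia.
Qed.

Lemma nth_zero_block j : nth false zero_block j = false.
Proof. by rewrite nth_nseq if_same. Qed.

Definition row_bit s fl v b (c : slot) : bool :=
  if b == s then up_bit fl v c
  else if b == s + L.+1 then own_bit fl v c
  else if b == s + L.+2 then right_bit fl v c else false.

Lemma row_blocksE s fl v b c : s < sites ->
  nth false (nth [::] (row_blocks s fl v) b) (enum_rank c) = row_bit s fl v b c.
Proof.
move=> lts; rewrite /row_blocks /row_bit.
have blockE f : nth false (block f) (enum_rank c) = f c.
  by rewrite (nth_map c) -?cardE ?ltn_ord // nth_enum_rank.
rewrite nth_cat size_nseq; have [ltb|leb] := ltnP b s.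
  rewrite nth_nseq ltb nth_zero_block.
  by do 3!(case: eqP => [|_]; first by lia).
have [->|nbs] := eqVneq b s; first by rewrite subnn /= blockE.
have [k ->] : exists k, b = s + k.+1 by exists (b - s).-1; lia.
rewrite addKn /= nth_cat size_nseq !eqn_add2l !eqSS.
have [ltk|lek] := ltnP k L.
  rewrite nth_nseq ltk nth_zero_block.
  by do 2!(case: eqP => [|_]; first by lia).
have [->|nkL] := eqVneq k L; first by rewrite subnn /= blockE.
have [k' ->] : exists k', k = L + k'.+1 by exists (k - L).-1; lia.
rewrite addKn /= -[L.+1]addn1 eqn_add2l; case: k' => [|k'] /=;
    first by rewrite blockE.
by rewrite nth_nseq; case: ifP; rewrite ?nth_zero_block // nth_nil.
Qed.

Lemma nth_row s fl v b c : s < sites ->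
  nth false (row s fl v) (b * #|slot| + enum_rank c) = row_bit s fl v b c.
Proof.
move=> lts; rewrite /row (nth_flatten_blocks _ _ (row_blocks_size _ _ _)) //.
exact: row_blocksE.
Qed.

Lemma half_scale_gt0 : 0 < half_scale.
Proof.
rewrite /half_scale addn_gt0; apply/orP; right.
by apply/card_gt0P; exists (tm_start N, [ffun=> (None, None)]).
Qed.

Lemma pad_gt0 : 0 < pad.
Proof. by rewrite /pad; have := half_scale_gt0; nia. Qed.

(** Two links count [1 + (#|hlink| - 1) + 1 + (#|vlink| - 1) = half_scale] bits, the [unit] slot
    standing in for the left link at the edge; [pad] supplies the rest. A window that violates its
    local condition gives the zero vector. *)
Lemma count_row s fl v :
  count id (row s fl v) = if local_ok fl v then 2 * half_scale ^ 2 else 0.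
Proof.
have cnt f : count id (block f) = \sum_h f (inl (inl h)) +
    \sum_z f (inl (inr z)) + (f (inr (inl tt)) + \sum_i f (inr (inr i))).
  by rewrite count_map count_enum !big_sumType /= (big_pred1 tt) // => -[].
have count0 k : count id (flatten (nseq k zero_block)) = 0.
  by elim: k => //= k IH; rewrite count_cat IH count_nseq.
rewrite /row /row_blocks !flatten_cat /= !flatten_cat /= !count_cat !count0
    !cnt /=.
have sum0 (T : finType) : \sum_(x : T) false = 0 by rewrite big1.
have sum1 (T : finType) (y : T) : \sum_x (y == x) = 1.
  by rewrite (bigD1 y) //= eqxx big1 // => x /negbTE; rewrite eq_sym => ->.
have sumN1 (T : finType) (y : T) : \sum_x (y != x) = #|T|.-1.
  apply/eqP; rewrite -(eqn_add2r 1) -{1}(sum1 _ y) -big_split /=.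
  rewrite (eq_bigr (fun=> 1)) => [|x _]; last by case: (_ == _).
  rewrite sum1_card addn1 prednK //; apply/card_gt0P; by exists y.
rewrite /own_bit /right_bit /up_bit; case: (local_ok fl v) => /=; last first.
  by rewrite !sum0.
have sumT (T : finType) : \sum_(x : T) true = #|T| by rewrite sum1_card.
have [h hE] : exists h, #|hlink| = h.+1.
  by exists #|hlink|.-1; rewrite prednK //; apply/card_gt0P;
      exists (link_left v).
have [z vE] : exists z, #|vlink| = z.+1.
  by exists #|vlink|.-1; rewrite prednK //; apply/card_gt0P; exists (link_up v).
rewrite /pad /half_scale.
by case: (is_edge fl) => /=; rewrite !sumN1 ?sum0 !sum1 !sumT card_ord !hE !vE;
    nia.
Qed.

(** This is orthogonality for vectors with nonnegative entries supported on the rows. *)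
Definition disjoint_rows (r r' : seq bool) : Prop :=
  forall j, ~~ (nth false r j && nth false r' j).

Lemma disjoint_rowsP s fl v s' fl' v' : s < sites -> s' < sites ->
  disjoint_rows (row s fl v) (row s' fl' v') <->
  forall b c, ~~ (row_bit s fl v b c && row_bit s' fl' v' b c).
Proof.
move=> lts lts'; split=> [dis b c|dis j]; first by rewrite -!nth_row.
have slot0 : 0 < #|slot| by apply/card_gt0P; exists (inr (inl tt)).
have ltj : j %% #|slot| < #|slot| by rewrite ltn_mod.
have := dis (j %/ #|slot|) (enum_val (Ordinal ltj)).
by rewrite -!nth_row // enum_valK /= -divn_eq.
Qed.

(** All nonzero rows of a site contain the padding coordinates of its own block, so an orthogonal
    selection takes at most one of them. *)
Lemma same_site_meet s fl v fl' v' :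
  s < sites -> local_ok fl v -> local_ok fl' v' ->
  ~ disjoint_rows (row s fl v) (row s fl' v').
Proof.
move=> lts ok ok' /disjoint_rowsP -/(_ lts lts).
move/(_ (s + L.+1) (inr (inr (Ordinal pad_gt0)))).
rewrite /row_bit eqxx; case: eqP => [|_]; first by lia.
by rewrite /own_bit ok ok'.
Qed.

Lemma disjoint_hlink s fl v fl' v' : s.+1 < sites ->
  local_ok fl v -> local_ok fl' v' -> ~~ is_edge fl' ->
  disjoint_rows (row s fl v) (row s.+1 fl' v') -> link_right v = link_left v'.
Proof.
move=> lts ok ok' ne /disjoint_rowsP -/(_ (ltnW lts) lts).
move/(_ (s + L.+2) (inl (inl (link_left v')))).
rewrite /row_bit addSnnS eqxx !eqn_add2l.
by do 3!(case: eqP => [|_]; first by lia); rewrite /right_bit /own_bit ok ok'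
    ne !andTb eqxx
  andbT negbK => /eqP.
Qed.

Lemma disjoint_vlink s fl v fl' v' : s + L.+1 < sites ->
  local_ok fl v -> local_ok fl' v' ->
  disjoint_rows (row s fl v) (row (s + L.+1) fl' v') ->
  link_down v = link_up v'.
Proof.
move=> lts ok ok' /disjoint_rowsP -/(_ (leq_ltn_trans (leq_addr _ _) lts) lts).
move/(_ (s + L.+1) (inl (inr (link_down v)))).
rewrite /row_bit eqxx; case: eqP => [|_]; first by lia.
by rewrite /up_bit /own_bit ok ok' eqxx negbK => /eqP.
Qed.

(** The rows can share only three kinds of block: own with up ([s' = s + L.+1]) and right with own
    ([s' = s.+1]), where the links agree, and right with up ([s' = s + L.+2]), which use different
    slots. The end of a line does not interact with the next edge site, whose slots for the left
    link are empty. *)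
Lemma links_disjoint s fl v s' fl' v' : s < s' -> s' < sites ->
  (s' = s.+1 -> ~~ is_edge fl' -> link_right v = link_left v') ->
  (s' = s + L.+1 -> link_down v = link_up v') ->
  disjoint_rows (row s fl v) (row s' fl' v').
Proof.
move=> ltss lts' hl vl; apply/disjoint_rowsP => // [|b c];
    first exact: ltn_trans lts'.
rewrite /row_bit.
have [bs|_] := eqVneq b s.
  by do 3!(case: eqP => [|_]; first by lia); rewrite andbF.
have [bs|_] := eqVneq b (s + L.+1).
  have [bs'|_] := eqVneq b s'.
    rewrite /own_bit /up_bit vl -?bs //; case: c => [[h|z]|z];
      rewrite ?andbF //.
    by case: (local_ok fl v); case: (local_ok fl' v'); case: (_ == _).
  by do 2!(case: eqP => [|_]; first by lia); rewrite andbF.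
have [bs|_] := eqVneq b (s + L.+2); last by [].
have [bs'|_] := eqVneq b s'.
  by rewrite /right_bit /up_bit; case: c => [[h|z]|z]; rewrite ?andbF.
have [bs'|_] := eqVneq b (s' + L.+1).
  rewrite /right_bit /own_bit; case: c => [[h|z]|z]; rewrite ?andbF //.
  case: (boolP (is_edge fl')) => [_|ne]; first by rewrite /= !andbF.
  rewrite (hl _ ne); last by lia.
  by case: (local_ok fl v); case: (local_ok fl' v'); case: (_ == _).
by case: eqP => [|_]; [lia | rewrite andbF].
Qed.

Definition default_window : window :=
  ((tm_start N, false, [ffun=> None]), [ffun=> (None, None)],
   ([ffun=> (None, None)], [ffun=> (None, None)], [ffun=> (None, None)])).

(* Repeating the rows of a site only serves to have at least as many vectors as
   coordinates. *)
Definition row_values : seq window :=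
  [seq x.1 | x <- enum {: window * 'I_(2 * #|slot|)}].

Definition site_flags (s : nat) : flags :=
  flags_at w L (s %/ L.+1) (s %% L.+1).

Definition site_rows (s : nat) : seq (seq bool) :=
  [seq row s (site_flags s) v | v <- row_values].

Definition row_at (i : nat) : seq bool :=
  nth [::] (site_rows (i %/ size row_values)) (i %% size row_values).

Lemma slot_gt0 : 0 < #|slot|.
Proof. by apply/card_gt0P; exists (inr (inl tt)). Qed.

Lemma mem_row_values v : v \in row_values.
Proof.
have lt0 : 0 < 2 * #|slot| by rewrite muln_gt0 slot_gt0.
by apply/mapP; exists (v, Ordinal lt0); rewrite ?mem_enum.
Qed.

Lemma size_row_values : size row_values = 2 * #|slot| * #|window|.
Proof. by rewrite size_map -cardE card_prod card_ord mulnC. Qed.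

Lemma size_row_values_gt0 : 0 < size row_values.
Proof. by have := mem_row_values default_window; case: row_values. Qed.

Lemma row_atE s v : row_at (s * size row_values + index v row_values) =
  row s (site_flags s) v.
Proof.
have lti : index v row_values < size row_values by rewrite index_mem
    mem_row_values.
rewrite /row_at divnMDl ?size_row_values_gt0 // divn_small // addn0 modnMDl.
by rewrite modn_small // (nth_map default_window) // nth_index ?mem_row_values.
Qed.

Lemma row_at_val i : row_at i = row (i %/ size row_values)
  (site_flags (i %/ size row_values))
  (nth default_window row_values (i %% size row_values)).
Proof. by rewrite {1}/row_at (nth_map default_window) // ltn_mod
    size_row_values_gt0. Qed.

Lemma rows_tableau :
  (exists S : {set 'I_(sites * size row_values)},
    [/\ #|S| = sites,
        forall i, i \in S -> count id (row_at i) = 2 * half_scale ^ 2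
      & forall i j, i \in S -> j \in S -> i != j ->
          disjoint_rows (row_at i) (row_at j)]) <->
  exists v : nat -> nat -> window, tableau w L v.
Proof.
set m := size row_values.
have m0 : 0 < m by exact: size_row_values_gt0.
split=> [[S [cardS norm dis]]|[v [okv hv vv]]].
  have lts (i : 'I_(sites * m)) : i %/ m < sites by rewrite ltn_divLR.
  pose site i := Ordinal (lts i).
  pose val i := nth default_window row_values (i %% m).
  have ok i : i \in S -> local_ok (site_flags (i %/ m)) (val i).
    move=> iS; have := norm i iS; rewrite row_at_val count_row;
      case: ifP => // _ E.
    by have := half_scale_gt0; rewrite -sqrn_gt0; move: E; lia.
  (* Two selected rows of one site would meet. Hence [S] injects into the sites, and since it has as
     many elements, it contains exactly one row of every site. *)
  have site_inj : {in S &, injective site}.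
    move=> i j iS jS /(congr1 (fun k : 'I_sites => k : nat)) /= eq_site.
    apply/eqP; apply: contraT => ij; have := dis i j iS jS ij.
    have := ok i iS; rewrite !row_at_val -/m eq_site => oki.
    by move/(same_site_meet (lts j) oki (ok j jS)).
  have site_surj s : exists i, i \in S /\ site i = s.
    have : s \in site @: S.
      suff -> : site @: S = setT by rewrite inE.
      apply/eqP; rewrite eqEcard subsetT cardsT card_ord
        (card_in_imset site_inj).
      by rewrite cardS /=.
    by case/imsetP => i iS ->; exists i.
  have [g gP] := fin_all_exists site_surj.
  have sites0 : 0 < sites by [].
  (* A tableau is a function on all of [nat]; outside the grid [at_] falls back on site 0. *)
  pose at_ t p : 'I_sites := insubd (Ordinal sites0) (t * L.+1 + p).
  have atE t p : t <= L.+1 -> p <= L -> at_ t p = t * L.+1 + p :> nat.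
    by move=> let_ lep; rewrite val_insubd ifT // /sites; nia.
  have flagE t p : p <= L -> site_flags (t * L.+1 + p) = flags_at w L t p.
    by move=> lep; rewrite /site_flags divnMDl // modnMDl divn_small //
      modn_small // addn0.
  have gS t p : g (at_ t p) \in S by case: (gP (at_ t p)).
  have gE t p : t <= L.+1 -> p <= L -> g (at_ t p) %/ m = t * L.+1 + p.
    move=> let_ lep; rewrite -atE //.
    by case: (gP (at_ t p)) => _ /(congr1 (fun k : 'I_sites => k : nat)).
  have rowE t p : t <= L.+1 -> p <= L -> row_at (g (at_ t p)) =
      row (t * L.+1 + p) (flags_at w L t p) (val (g (at_ t p))).
    by move=> let_ lep; rewrite row_at_val gE // flagE.
  have okg t p : t <= L.+1 -> p <= L ->
      local_ok (flags_at w L t p) (val (g (at_ t p))).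
    by move=> let_ lep; have := ok _ (gS t p); rewrite gE // flagE.
  have g_neq t p t' p' : t <= L.+1 -> p <= L -> t' <= L.+1 -> p' <= L ->
      t * L.+1 + p != t' * L.+1 + p' -> g (at_ t p) != g (at_ t' p').
    move=> let_ lep let_' lep'; apply: contraNneq => e.
    by rewrite -!gE // e.
  exists (fun t p => val (g (at_ t p))); split=> // [t p let_ ltp|t p let_ lep].
    apply: (@disjoint_hlink (t * L.+1 + p) (flags_at w L t p) _
                            (flags_at w L t p.+1)); rewrite ?okg //; try lia.
      by rewrite /sites; nia.
    rewrite -addnS -!rowE ?(ltnW ltp) //; apply: dis; rewrite ?gS //.
    by apply: g_neq; rewrite ?(ltnW ltp) // eqn_add2l; lia.
  apply: (@disjoint_vlink (t * L.+1 + p) (flags_at w L t p) _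
                          (flags_at w L t.+1 p)); rewrite ?okg //; try lia.
    by rewrite /sites; nia.
  rewrite (_ : _ + _ + L.+1 = t.+1 * L.+1 + p) -?rowE; try lia.
  apply: dis; rewrite ?gS //; apply: g_neq; lia.
pose val s := v (s %/ L.+1) (s %% L.+1).
have lt_idx (s : 'I_sites) : s * m + index (val s) row_values < sites * m.
  have := ltn_ord s; have : index (val s) row_values < m by rewrite index_mem
      mem_row_values.
  by nia.
pose f s := Ordinal (lt_idx s).
have rowE s : row_at (f s) = row s (site_flags s) (val s) by exact: row_atE.
have f_div (s : 'I_sites) : f s %/ m = s.
  by rewrite /= divnMDl // divn_small ?addn0 // index_mem mem_row_values.
have f_inj : injective f.
  by move=> s s' e; apply/val_inj; rewrite /= -f_div e f_div.
have lt_div (s : 'I_sites) : s %/ L.+1 <= L.+1.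
  by rewrite -ltnS ltn_divLR //; exact: ltn_ord.
have le_mod s : s %% L.+1 <= L by rewrite -ltnS ltn_mod.
have okf (s : 'I_sites) : local_ok (site_flags s) (val s) by exact: okv.
have dis_lt (s s' : 'I_sites) : s < s' -> disjoint_rows (row_at (f s))
    (row_at (f s')).
  move=> ltss; rewrite !rowE; apply: links_disjoint => // [es ne|es];
      rewrite /val.
    (* Since [s'] is not at the edge, the successor of [s] stays on the same line. *)
    have [q r] : s' %/ L.+1 = s %/ L.+1 /\ s' %% L.+1 = (s %% L.+1).+1.
      move: ne; rewrite /= es; have := ltn_pmod s (ltn0Sn L).
      rewrite {2 3 5}(divn_eq s L.+1) -addnS ltnS modnMDl divnMDl //.
      rewrite leq_eqVlt => /predU1P[->|ltr]; first by rewrite modnn.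
      have ltr1 : (s %% L.+1).+1 < L.+1 by [].
      by rewrite (divn_small ltr1) (modn_small ltr1) addn0.
    rewrite q r; apply: hv => //; by rewrite -r; apply: le_mod.
  have [-> ->] : s' %/ L.+1 = (s %/ L.+1).+1 /\ s' %% L.+1 = s %% L.+1.
    by rewrite es divnDr // divnn addn1 modnDr.
  apply: vv => //; rewrite -ltnS ltn_divLR //.
  have sitesE : sites = L.+1 + L.+1 * L.+1 by rewrite /sites mulSn.
  have := ltn_ord s'; rewrite es; lia.
exists (f @: setT); split=> [|_ /imsetP[s _ ->]|_ _ /imsetP[s _ ->]
    /imsetP[s' _ ->]].
- by rewrite card_imset // cardsT card_ord.
- by rewrite rowE count_row okf.
move=> ne; have {ne} : s != s' by apply: contraNneq ne => ->.
rewrite -val_eqE neq_ltn => /orP[|] /dis_lt // dis j; rewrite andbC; exact: dis.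
Qed.

End Rows.

(** * A programming language for polynomial-time machines *)

Section Language.
Variable nw : nat.
Local Notation reg := 'I_nw.+1.
Local Notation bcell := (cell void).

(* A small imperative language on the tapes of a machine; [While r c] runs [c]
   as long as the cell scanned on tape [r] is not blank. *)
Inductive cmd :=
| Op of nat & (bcell -> bcell * move)
| Seq of cmd & cmd
| Case of nat & cmd & cmd & cmd
| While of nat & cmd.

Definition tapes := {ffun reg -> tape void}.
Definition reads := {ffun reg -> bcell}.

Definition idle (rd : reads) : {ffun reg -> bcell * move} :=
  [ffun i => (rd i, Stay)].

(* The state of the machine is the list of the commands that remain to be
   executed. *)
Definition next (k : seq cmd) (rd : reads) :
    seq cmd * {ffun reg -> bcell * move} :=
  match k with
  | [::] => ([::], idle rd)
  | Op r f :: k =>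
      (k, [ffun i : reg => if i == r :> nat then f (rd i) else (rd i, Stay)])
  | Seq a b :: k => (a :: b :: k, idle rd)
  | Case r a b c :: k =>
      (match rd (inord r) with
       | None => a
       | Some (inl false) => b
       | Some _ => c
       end :: k, idle rd)
  | While r c :: k =>
      (if rd (inord r) is None then k else c :: While r c :: k, idle rd)
  end.

Definition reads_of (t : tapes) : reads := [ffun i => tape_read (t i)].

Definition act_on (t : tapes) (acts : {ffun reg -> bcell * move}) : tapes :=
  [ffun i => tape_act (t i) (acts i)].

Definition kstep (kt : seq cmd * tapes) : seq cmd * tapes :=
  if nilp kt.1 then kt else
  let ka := next kt.1 (reads_of kt.2) in (ka.1, act_on kt.2 ka.2).

(** A machine needs finitely many states. These are the lists of pending commands that can occur
    while [c] is executed with [k] left to do, apart from [k] itself; a loop returns to itself,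
    which keeps the list finite. *)
Fixpoint conts (c : cmd) (k : seq cmd) : seq (seq cmd) :=
  (c :: k) :: match c with
  | Op _ _ => [::]
  | Seq a b => conts a (b :: k) ++ conts b k
  | Case _ a b c => conts a k ++ conts b k ++ conts c k
  | While r c' => conts c' (c :: k)
  end.

(** [Op] carries a function, so equality of commands is decided classically to make these lists a
    finite type. *)
Definition kstates (p : cmd) : seq {classic (seq cmd)} :=
  [::] :: conts p [::].

Lemma mem_conts (c : cmd) (k : seq cmd) :
  ((c :: k : {classic (seq cmd)}) \in (conts c k : seq {classic (seq cmd)})).
Proof. by case: c => *; rewrite inE eqxx. Qed.

Lemma conts_next (c : cmd) (k l : seq cmd) (rd : reads) :
  ((l : {classic (seq cmd)}) \in (conts c k : seq {classic (seq cmd)})) ->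
  ((next l rd).1 : {classic (seq cmd)}) \in
    ((k : {classic (seq cmd)}) :: conts c k).
Proof.
elim: c k => [r f|a IHa b IHb|r a IHa b IHb c IHc|r c IHc] k /=; rewrite !inE.
- by move=> /eqP -> /=; rewrite eqxx.
- case/predU1P => [-> /=|]; first by rewrite mem_cat mem_conts !orbT.
  rewrite !mem_cat => /orP[/IHa|/IHb]; rewrite !inE => /predU1P[->|->];
    by rewrite ?mem_conts ?eqxx ?orbT.
- case/predU1P => [-> /=|].
    by rewrite !mem_cat; case: (rd _) => [[[]|[]]|]; rewrite mem_conts !orbT.
  rewrite !mem_cat => /or3P[/IHa|/IHb|/IHc]; rewrite !inE => /predU1P[->|->];
    by rewrite ?eqxx ?orbT.
case/predU1P => [-> /=|/IHc].
  by case: (rd _) => [_|]; rewrite ?eqxx // mem_conts !orbT.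
by rewrite !inE => /predU1P[->|->]; rewrite ?eqxx ?orbT.
Qed.

(** Closure under [next]: the default of [insubd] in [kdelta] is never taken. *)
Lemma kstates_next (p : cmd) (l : seq cmd) (rd : reads) :
  ((l : {classic (seq cmd)}) \in kstates p) ->
  ((next l rd).1 : {classic (seq cmd)}) \in kstates p.
Proof.
rewrite /kstates inE => /predU1P[->|]; first by rewrite inE eqxx.
exact: conts_next.
Qed.

Definition start_state (p : cmd) : seq_sub (kstates p) :=
  @SeqSub _ (kstates p) [:: p]
    (mem_behead (s := kstates p) (mem_conts p [::])).

Definition kdelta (p : cmd) (_ : unit) (q : seq_sub (kstates p)) (rd : reads) :
    seq_sub (kstates p) * {ffun reg -> bcell * move} :=
  let ka := next (ssval q) rd in (insubd q (ka.1 : {classic (seq cmd)}), ka.2).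

Definition machine (p : cmd) : tm unit :=
  @TM unit nw void (seq_sub (kstates p)) (start_state p)
    (fun q => nilp (ssval q)) xpredT (@kdelta p).

Lemma machine_step (p : cmd) (c : config (machine p)) :
  let c' := step c tt in
  (ssval (conf_state c'), conf_tapes c') =
    kstep (ssval (conf_state c), conf_tapes c).
Proof.
case: c => [[q qP] t]; rewrite /step /halted /kstep.
rewrite [tm_halt _]/(nilp q) [conf_state _]/= [conf_tapes _]/= [ssval _]/=.
rewrite /nilp /=; case: (size q == 0) => //=; rewrite -/(reads_of t).
by rewrite -[ssval _]/(val _) val_insubd (kstates_next _ qP).
Qed.

Lemma machine_run (p : cmd) (w : seq bool) n :
  let c := run (machine p) (nseq n tt) w in
  (ssval (conf_state c), conf_tapes c) =
    iter n kstep ([:: p], conf_tapes (init (machine p) w)).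
Proof.
elim: n => [|n IH] //=.
have -> : tt :: nseq n tt = rcons (nseq n tt) tt by elim: n {IH} => //= n ->.
by rewrite /run foldl_rcons machine_step IH.
Qed.

(** A register is a stack with its top under the head. Popping leaves a blank on the left and
    rewriting a scanned blank makes it explicit, hence the arbitrary numbers of listed blanks on
    both sides. *)
Definition holds (t : tape void) (s : seq bool) : Prop :=
  exists k l, t = Tape (nseq k None) (map (@Some _ \o inl) s ++ nseq l None).

Definition represents (t : tapes) (st : seq (seq bool)) : Prop :=
  forall i : reg, holds (t i) (nth [::] st i).

Definition does_on (c : cmd) (st st' : seq (seq bool)) (n : nat) : Prop :=
  forall t, represents t st -> exists t' m,
    [/\ m <= n, represents t' st'
      & forall k, iter m kstep (c :: k, t) = (k, t')].

Lemma holds_read t s : holds t s -> tape_read t = ohead (map inl s).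
Proof. by case=> k [l ->]; case: s => //; case: l. Qed.

Lemma holds_idle t s : holds t s -> holds (tape_act t (tape_read t, Stay)) s.
Proof.
case=> k [l ->]; exists k; case: s => [|b s] /=; last by exists l.
by exists l.-1.+1; case: l.
Qed.

Definition idled (t : tapes) : tapes := act_on t (idle (reads_of t)).

Lemma represents_idled t st : represents t st -> represents (idled t) st.
Proof. by move=> rt i; rewrite !ffunE; apply: holds_idle. Qed.

Lemma represents_read t st r : represents t st -> r <= nw ->
  reads_of t (inord r) = ohead (map inl (nth [::] st r)).
Proof. by move=> rt ler; rewrite ffunE (holds_read (rt _)) inordK. Qed.

Lemma does_le c st st' n n' : n <= n' -> does_on c st st' n ->
    does_on c st st' n'.
Proof.
move=> lenn' H t /H [t' [m [lemn rt' mE]]]; exists t', m; split=> //.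
exact: leq_trans lenn'.
Qed.

Lemma does_seq a b st1 st2 st3 n n' :
  does_on a st1 st2 n -> does_on b st2 st3 n' ->
      does_on (Seq a b) st1 st3 (n + n').+1.
Proof.
move=> Ha Hb t rt; have [t1 [m1 [le1 rt1 E1]]] := Ha _ (represents_idled rt).
have [t2 [m2 [le2 rt2 E2]]] := Hb _ rt1.
exists t2, (m2 + m1).+1; split=> // [|k]; first by lia.
by rewrite iterSr iterD -[kstep _]/(a :: b :: k, idled t) E1 E2.
Qed.

Lemma does_case r a b c st st' n : r <= nw ->
  (nth [::] st r = [::] -> does_on a st st' n) ->
  (forall s, nth [::] st r = false :: s -> does_on b st st' n) ->
  (forall s, nth [::] st r = true :: s -> does_on c st st' n) ->
  does_on (Case r a b c) st st' n.+1.
Proof.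
move=> ler Ha Hb Hc t rt; have rdE := represents_read rt ler.
pose d := match reads_of t (inord r) with
  | None => a | Some (inl false) => b | Some _ => c end.
have Hd : does_on d st st' n.
  rewrite /d rdE; case: (nth [::] st r) Ha Hb Hc => [Ha _ _|[] s Ha Hb Hc] /=;
      eauto.
have [t1 [m1 [le1 rt1 E1]]] := Hd _ (represents_idled rt).
exists t1, m1.+1; split=> // k.
by rewrite iterSr -[kstep _]/(d :: k, idled t) E1.
Qed.

Lemma does_while_nil r c st : r <= nw -> nth [::] st r = [::] ->
  does_on (While r c) st st 1.
Proof.
move=> ler st0 t rt; exists (idled t), 1; split=> //;
    first exact: represents_idled.
by move=> k; rewrite /= /kstep /= (represents_read rt ler) st0.
Qed.

Lemma does_while_cons r c st1 st2 st3 n n' : r <= nw ->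
    nth [::] st1 r != [::] ->
  does_on c st1 st2 n -> does_on (While r c) st2 st3 n' ->
  does_on (While r c) st1 st3 (n + n').+1.
Proof.
move=> ler st0 Hc Hw t rt; have [t1 [m1 [le1 rt1 E1]]] :=
    Hc _ (represents_idled rt).
have [t2 [m2 [le2 rt2 E2]]] := Hw _ rt1.
exists t2, (m2 + m1).+1; split=> // [|k]; first by lia.
rewrite iterSr iterD (_ : kstep _ = (c :: While r c :: k, idled t)) ?E1 ?E2 //.
by rewrite /kstep /= (represents_read rt ler); case: (nth _ _ _) st0.
Qed.

Lemma does_op r f st s : r <= nw ->
  (forall t, holds t (nth [::] st r) -> holds (tape_act t (f (tape_read t))) s)
      ->
  does_on (Op r f) st (set_nth [::] st r s) 1.
Proof.
move=> ler H t rt.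
exists (act_on t (next [:: Op r f] (reads_of t)).2), 1; split=> // i.
rewrite /= !ffunE nth_set_nth /=; case: eqP => [ir|_]; last exact: holds_idle.
by apply: H; rewrite -ir.
Qed.

Definition Push (r : nat) (b : bool) : cmd :=
  Seq (Op r (fun x => (x, MoveLeft))) (Op r (fun=> (Some (inl b), Stay))).

Definition Pop (r : nat) : cmd := Op r (fun=> (None, MoveRight)).

Definition Skip : cmd := Op 0 (fun x => (x, Stay)).

Lemma does_pop r st : r <= nw ->
  does_on (Pop r) st (set_nth [::] st r (behead (nth [::] st r))) 1.
Proof.
move=> ler; apply: does_op => // t [k [l ->]]; exists k.+1.
case: (nth _ _ _) => [|b s] /=; last by exists l.
by exists l.-1; rewrite /tape_act /=; case: l.
Qed.
Arguments does_pop {r} st _.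

Lemma does_skip st : does_on Skip st st 1.
Proof.
move=> t rt; exists (act_on t (next [:: Skip] (reads_of t)).2), 1; split=> // i.
by rewrite !ffunE if_same; exact: holds_idle.
Qed.
Arguments does_skip st.

Lemma does_push r b st : r <= nw ->
  does_on (Push r b) st (set_nth [::] st r (b :: nth [::] st r)) 3.
Proof.
move=> ler t rt.
pose t1 := act_on (idled t) (next [:: Op r (fun x => (x, MoveLeft))]
    (reads_of (idled t))).2.
pose t2 := act_on t1 (next [:: Op r (fun=> (Some (inl b), Stay))]
    (reads_of t1)).2.
exists t2, 3; split=> // i.
rewrite !ffunE nth_set_nth /=; case: eqP => [ir|_]; last first.
  by do !apply: holds_idle.
have [k [l ->]] := holds_idle (rt i); rewrite -ir.
exists k.-1; exists (if nth [::] st i is [::] then l.-1.+1 else l).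
by case: k => [|k]; case: (nth [::] st i) => //=; case: l.
Qed.
Arguments does_push {r} b st _.
Lemma does_loop r c (inv : nat -> seq (seq bool)) n cost : r <= nw ->
  (forall i, i < n -> nth [::] (inv i) r != [::]) ->
      nth [::] (inv n) r = [::] ->
  (forall i, i < n -> does_on c (inv i) (inv i.+1) cost) ->
  does_on (While r c) (inv 0) (inv n) (n * cost.+1).+1.
Proof.
move=> ler; elim: n inv => [|n IH] inv ne nil0 body.
  exact: does_while_nil.
apply: (@does_le _ _ _ (cost + (n * cost.+1).+1).+1); first by rewrite mulSn;
    lia.
apply: does_while_cons (body 0 isT) _ => //; first exact: ne.
by apply: (IH (fun i => inv i.+1)) => // i lti; [exact: ne | exact: body].
Qed.

Definition unary (n : nat) : seq bool := nseq n true.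

(* The register [t] counts the iterations already begun and is empty again at
   the end, when [r] has its initial contents. *)
Definition Rep (r t : nat) (body : cmd) : cmd :=
  Seq (While r (Seq (Pop r) (Seq (Push t true) body)))
      (While t (Seq (Pop t) (Push r true))).

(** The four equations say that [F] describes the store with [r] and [t] as its first two arguments,
    so that the progress of [body] is expressed by the index alone. Each iteration costs 7 steps on
    the way out and 6 to restore [r]. *)
Lemma does_rep (F : seq bool -> seq bool -> nat -> seq (seq bool)) r t body n
    cost :
  r <= nw -> t <= nw ->
  (forall x y i, nth [::] (F x y i) r = x) ->
  (forall x y i, nth [::] (F x y i) t = y) ->
  (forall x y i z, set_nth [::] (F x y i) r z = F z y i) ->
  (forall x y i z, set_nth [::] (F x y i) t z = F x z i) ->
  (forall i, i < n -> does_on body (F (unary (n - i.+1)) (unary i.+1) i)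
                                (F (unary (n - i.+1)) (unary i.+1) i.+1) cost)
                                  ->
  does_on (Rep r t body) (F (unary n) [::] 0) (F (unary n) [::] n)
    (n * (cost + 13) + 3).
Proof.
move=> ler let_ Fr Ft setr sett Hbody.
apply: (@does_le _ _ _
  ((n * (1 + (3 + cost).+1).+1.+1).+1 + (n * (1 + 3).+1.+1).+1).+1).
  by nia.
apply: does_seq.
  have := @does_loop r (Seq (Pop r) (Seq (Push t true) body))
    (fun i => F (unary (n - i)) (unary i) i) n (1 + (3 + cost).+1).+1 ler.
  rewrite subn0; apply=> [i lti||i lti].
  - by rewrite Fr -subnSK.
  - by rewrite Fr subnn.
  apply: (does_seq (does_pop _ ler)); rewrite Fr setr.
  apply: (does_seq (does_push true _ let_)); rewrite Ft sett.
  by rewrite -subnSK //; exact: Hbody.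
have := @does_loop t (Seq (Pop t) (Push r true))
  (fun i => F (unary i) (unary (n - i)) n) n (1 + 3).+1 let_.
rewrite subn0 subnn; apply=> [i lti||i lti]; rewrite ?Ft //.
  by rewrite -subnSK.
apply: (does_seq (does_pop _ let_)); rewrite Ft sett.
by have := does_push true (F (unary i) (behead (unary (n - i))) n) ler;
  rewrite Fr setr -subnSK.
Qed.

Definition Seqs (cs : seq cmd) : cmd := foldr Seq Skip cs.

Lemma does_seqs (T : Type) (body : T -> cmd) (g : T -> seq bool) (xs : seq T)
    (F : seq bool -> seq (seq bool)) o cost :
  (forall x o, does_on (body x) (F o) (F (catrev (g x) o)) cost) ->
  does_on (Seqs (map body xs)) (F o) (F (catrev (flatten (map g xs)) o))
    (size xs * cost.+1).+1.
Proof.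
move=> H; elim: xs o => [|x xs IH] o /=; first exact: does_skip.
apply: (@does_le _ _ _ (cost + (size xs * cost.+1).+1).+1);
    first by rewrite mulSn; lia.
apply: (does_seq (H x o)).
by rewrite catrev_catl; exact: IH.
Qed.

Definition Emit (r : nat) (s : seq bool) : cmd := Seqs (map (Push r) s).

Lemma does_emit (F : seq bool -> seq (seq bool)) r s o : r <= nw ->
  (forall o, nth [::] (F o) r = o) ->
  (forall o z, set_nth [::] (F o) r z = F z) ->
  does_on (Emit r s) (F o) (F (catrev s o)) (size s * 4).+1.
Proof.
move=> ler Fr setr.
have := @does_seqs _ (Push r) (fun b => [:: b]) s F o 3.
have -> : flatten [seq [:: b] | b <- s] = s by elim: s {o} => //= b s ->.
apply=> x o' /=; have := does_push x (F o') ler.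
by rewrite Fr setr.
Qed.

Lemma machine_output (p : cmd) (w v : seq bool) st n n' :
  does_on p (w :: nseq nw [::]) st n -> nth [::] st 0 = v -> n < n' ->
  let final := run (machine p) (nseq n' tt) w in
  halted final /\ has_output final v.
Proof.
move=> Hp outE ltn; have rt : represents (conf_tapes (init (machine p) w))
    (w :: nseq nw [::]).
  move=> i; rewrite ffunE; exists 0, 0; rewrite cats0; congr Tape.
  have [->|ne] := eqVneq i ord0; first by [].
  case: i ne => [[|i] lti] //= _; by rewrite nth_nseq if_same.
have [t [m [lem rt' E]]] := Hp _ rt.
have lemn' : m <= n' by lia.
have := machine_run p w n'; cbv zeta; set c := run _ _ _.
rewrite -{1}(subnK lemn') iterD E.
have -> : forall k, iter k kstep ([::], t) = ([::], t) by elim=> //= k ->.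
case=> q0 tE; split; first by rewrite /halted /= q0.
have [k [l tk]] := rt' ord0; rewrite /has_output tE tk /= outE.
by exists (nseq l None) => //; case: l {tk}.
Qed.

End Language.
Arguments does_pop {nw r} st _.
Arguments does_push {nw r} b st _.
Arguments does_skip {nw} st.

(** * Closure properties of polynomial bounds *)

Definition poly_bounded (f : nat -> nat) : Prop :=
  exists c, forall n, f n <= poly_bound c n.

Lemma leq_poly_bound c c' n : c <= c' -> poly_bound c n <= poly_bound c' n.
Proof.
move=> lec; rewrite /poly_bound leq_add //.
case: n => [|n]; last by rewrite leq_mul // leq_pexp2l.
by case: c lec => // c lec; rewrite exp0n // muln0.
Qed.

Lemma poly_bounded_const k : poly_bounded (fun=> k).
Proof. by exists k => n; exact: leq_addl. Qed.

Lemma poly_bounded_id : poly_bounded id.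
Proof. by exists 1 => n; rewrite /poly_bound expn1 mul1n leq_addr. Qed.

Lemma poly_bounded_add f g :
  poly_bounded f -> poly_bounded g -> poly_bounded (fun n => f n + g n).
Proof.
case=> c Hf [c' Hg]; pose m := maxn c c'; exists (2 * m) => n.
have le1 := leq_trans (Hf n) (leq_poly_bound n (leq_maxl c c')).
have le2 := leq_trans (Hg n) (leq_poly_bound n (leq_maxr c c')).
apply: leq_trans (leq_add le1 le2) _; rewrite -/m /poly_bound.
have : m * n ^ m <= m * n ^ (2 * m).
  case: n {le1 le2} => [|n]; last by rewrite leq_mul2l leq_pexp2l ?orbT //; lia.
  by case: m => // m; rewrite exp0n // muln0.
by nia.
Qed.

Lemma poly_bounded_succ f : poly_bounded f -> poly_bounded (fun n => (f n).+1).
Proof.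
move=> Hf; have [c H] := poly_bounded_add Hf (poly_bounded_const 1).
by exists c => n; rewrite -addn1.
Qed.

Lemma poly_bounded_mul f g :
  poly_bounded f -> poly_bounded g -> poly_bounded (fun n => f n * g n).
Proof.
(* With [E = n ^ m], one has [(m E + m) ^ 2 <= 3 m ^ 2 E ^ 2 + m ^ 2] and [E ^ 2 = n ^ (2 m)]; the
   constant dominates both the coefficient and the exponent. *)
case=> c Hf [c' Hg]; pose m := maxn c c'; exists (3 * m ^ 2 + 2 * m) => n.
have le1 := leq_trans (Hf n) (leq_poly_bound n (leq_maxl c c')).
have le2 := leq_trans (Hg n) (leq_poly_bound n (leq_maxr c c')).
apply: leq_trans (leq_mul le1 le2) _; rewrite -/m.
apply: (@leq_trans (3 * m ^ 2 * n ^ (2 * m) + m ^ 2)).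
  have -> : n ^ (2 * m) = n ^ m * n ^ m by rewrite mul2n -addnn expnD.
  rewrite /poly_bound; move: (n ^ m) => e; have : m ^ 2 * e <= m ^ 2 * (e * e).
    case: e => [|e]; first by rewrite !muln0.
    by rewrite leq_mul2l leq_pmull ?orbT.
  by lia.
rewrite /poly_bound leq_add //; last by nia.
case: n {le1 le2} => [|n]; last by rewrite leq_mul ?leq_pexp2l //; lia.
by case: m => // m; rewrite exp0n // muln0.
Qed.

Lemma poly_bounded_exp f k : poly_bounded f -> poly_bounded (fun n => f n ^ k).
Proof.
move=> Hf; elim: k => [|k IH]; first exact: poly_bounded_const.
have [c H] := poly_bounded_mul Hf IH.
by exists c => n; rewrite expnS.
Qed.

Lemma poly_bounded_le f g :
  (forall n, f n <= g n) -> poly_bounded g -> poly_bounded f.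
Proof. by move=> le [c Hg]; exists c => n; exact: leq_trans (Hg n). Qed.

Lemma poly_bounded_sub f g :
  poly_bounded f -> poly_bounded (fun n => f n - g n).
Proof. by apply: poly_bounded_le => n; exact: leq_subr. Qed.

Lemma does_polytime nw (p : cmd) (f : seq bool -> seq bool) (T : nat -> nat) :
  poly_bounded T ->
  (forall w, exists2 st, does_on nw p (w :: nseq nw [::]) st (T (size w))
                       & nth [::] st 0 = f w) ->
  polytime f.
Proof.
move=> HT Hp; have [c Hc] := poly_bounded_add (poly_bounded_const 1) HT.
exists (machine nw p), c => w; have [st Hst outE] := Hp w.
exact: machine_output Hst outE (Hc _).
Qed.

(** * A program for the reduction *)

Lemma nat_bitsS n : 0 < n -> nat_bits n = odd n :: nat_bits n./2.
Proof.
move=> n0; rewrite /nat_bits.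
have -> : up_log 2 n.+1 = (up_log 2 (n./2).+1).+1.
  apply: up_log_eq => //.
  set k := up_log _ _; have lek : n./2 < 2 ^ k by exact: up_logP.
  have nE := odd_double_half n; rewrite -muln2 in nE.
  rewrite expnS; apply/andP; split; last by lia.
  have [->|] := eqVneq k 0; first by rewrite expn0; lia.
  case E : k => [//|k'] _.
  suff : 2 ^ k' < n./2.+1 by rewrite expnS; lia.
  have : ~~ (n./2.+1 <= 2 ^ k').
    by apply/negP => /up_log_min; rewrite -/k E => /(_ isT); rewrite ltnn.
  by rewrite -ltnNge.
rewrite /= expn0 divn1; congr (_ :: _).
rewrite (iotaDl 1 0) -map_comp; apply: eq_map => i /=.
by rewrite add1n expnS divnMA divn2.
Qed.

(* Register 0 holds the input and finally the output, 1 the reversed output,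
   2 to 4 are the scratch registers of [EncNat], 5, 7 and 9 hold the side of the
   grid and are iterated over with the counters 6, 8 and 10, and 11 and 12
   hold the numbers of sites before and after the current one. *)
Local Notation does := (@does_on 12).
Local Notation St io o u v f a x p p' t t' s0 s1 :=
  [:: io; o; u; v; f; a; x; p; p'; t; t'; s0; s1].
Local Notation "a ;; b" := (Seq a b) (at level 60, right associativity).

Lemma catrev_unary k m : catrev (unary k) (unary m) = unary (k + m).
Proof. by elim: k m => //= k IH m; rewrite (IH m.+1) addnS. Qed.

Lemma flatten_nseq_unary n k : flatten (nseq n (unary k)) = unary (n * k).
Proof. by elim: n => //= n ->; rewrite mulSn /unary nseqD. Qed.

Lemma does_rep_emit (G : seq bool -> seq bool -> seq bool -> seq (seq bool))
    r t q str n o :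
  r <= 12 -> t <= 12 -> q <= 12 ->
  (forall x y o, [/\ nth [::] (G x y o) r = x, nth [::] (G x y o) t = y
                   & nth [::] (G x y o) q = o]) ->
  (forall x y o z, [/\ set_nth [::] (G x y o) r z = G z y o,
                       set_nth [::] (G x y o) t z = G x z o
                     & set_nth [::] (G x y o) q z = G x y z]) ->
  does (Rep r t (Emit q str)) (G (unary n) [::] o)
    (G (unary n) [::] (catrev (flatten (nseq n str)) o))
    (n * (size str * 4 + 14) + 3).
Proof.
move=> ler let_ leq Gn Gs.
have := @does_rep 12 (fun x y i => G x y (catrev (flatten (nseq i str)) o))
  r t (Emit q str) n (size str * 4).+1 ler let_.
rewrite addSnnS; apply=> [x y i|x y i|x y i z|x y i z|i lti].
- by case: (Gn x y (catrev (flatten (nseq i str)) o)).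
- by case: (Gn x y (catrev (flatten (nseq i str)) o)).
- by case: (Gs x y (catrev (flatten (nseq i str)) o) z).
- by case: (Gs x y (catrev (flatten (nseq i str)) o) z).
have -> : flatten (nseq i.+1 str) = flatten (nseq i str) ++ str.
  by elim: i {lti} => [|i IH] /=; rewrite ?cats0 // -catA -IH.
rewrite catrev_catl; apply: (does_emit (F := fun o => G _ _ o)) => // [o'|o' z].
  by case: (Gn (unary (n - i.+1)) (unary i.+1) o').
by case: (Gs (unary (n - i.+1)) (unary i.+1) o' z).
Qed.

(** Division by 2 in unary: register 2 is consumed in pairs, each counted in register 3, and a
    leftover unit is noted in register 4. *)
Definition HalfLoop : cmd :=
  While 2 (Pop 2 ;; Case 2 (Push 4 true) (Pop 2 ;; Push 3 true)
      (Pop 2 ;; Push 3 true)).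

(** Repeated halving produces the bits in the order of [nat_bits], least significant first, each
    written after its marker [true]. *)
Definition EncNat : cmd :=
  While 2 (HalfLoop ;;
           Case 4 (Emit 1 [:: true; false]) Skip
             (Pop 4 ;; Emit 1 [:: true; true]) ;;
           While 3 (Pop 3 ;; Push 2 true)) ;;
  Emit 1 [:: false].

Lemma does_half_loop n m io o a x p p' t t' s0 s1 :
  does HalfLoop (St io o (unary n) (unary m) [::] a x p p' t t' s0 s1)
    (St io o [::] (unary (n./2 + m)) (nseq (odd n) true) a x p p' t t' s0 s1)
    (n * 9 + 1).
Proof.
elim/ltn_ind: n m => -[|[|n]] IH m.
- exact: does_while_nil.
- apply: (@does_le _ _ _ _ ((1 + 4).+1 + 1).+1) => //.
  apply: does_while_cons => //; last exact: does_while_nil.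
  apply: does_seq; first exact: does_pop.
  by apply: does_case => //= _; exact: does_push.
apply: (@does_le _ _ _ _ ((1 + 6).+1 + (n * 9 + 1)).+1); first by lia.
apply: does_while_cons; last 1 first.
- have := IH n _ m.+1; rewrite addnS /= negbK; apply; lia.
- by [].
- by [].
apply: does_seq; first exact: does_pop.
by apply: does_case => //= s' _; apply: (@does_seq _ _ _ _ _ _ 1 3);
   [exact: does_pop | exact: does_push].
Qed.

Lemma does_enc_nat n io o a x p p' t t' s0 s1 :
  does EncNat (St io o (unary n) [::] [::] a x p p' t t' s0 s1)
    (St io (catrev (enc_nat n) o) [::] [::] [::] a x p p' t t' s0 s1)
    (n * (n * 15 + 40) + 10).
Proof.
apply: (@does_le _ _ _ _ (n * (n * 15 + 40) + 1 + 5).+1); first by lia.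
pose str n := flatten [seq [:: true; b] | b <- nat_bits n].
have -> : catrev (enc_nat n) o = catrev [:: false] (catrev (str n) o).
  by rewrite /enc_nat catrev_catl.
apply: does_seq; last first.
  exact: (@does_emit _ (fun o => St io o [::] [::] [::] a x p p' t t' s0 s1)).
elim/ltn_ind: n o => -[|n] IH o; first exact: does_while_nil.
set h := n.+1./2; have lth : h < n.+1 by rewrite /h; lia.
apply: (@does_le _ _ _ _ ((n.+1 * 9 + 1 + (12 + (h * 7).+1).+1).+1 +
                          (h * (h * 15 + 40) + 1)).+1).
  by rewrite /h; nia.
have strE : catrev (str n.+1) o = catrev (str h) (odd n.+1 :: true :: o).
  by rewrite /str nat_bitsS.
rewrite strE; apply: does_while_cons; last exact: IH.
- by [].
- by [].
apply: does_seq; first exact: (@does_half_loop n.+1 0).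
rewrite addn0 -/h.
apply: (@does_seq _ _ _ _
  (St io (odd n.+1 :: true :: o) [::] (unary h) [::] a x p p' t t' s0 s1)).
  apply: does_case => // [|s'|s'].
  - case: (odd n.+1) => // _.
    apply: (@does_le _ _ _ _ 9) => //.
    exact: (@does_emit _ (fun o => St io o [::] (unary h) [::] a x p p' t t' s0
      s1)).
  - by case: (odd n.+1).
  case: (odd n.+1) => // _.
  apply: (@does_seq _ _ _ _ _ _ 1 9); first exact: does_pop.
  exact: (@does_emit _ (fun o => St io o [::] (unary h) [::] a x p p' t t' s0
      s1)).
have := @does_loop 12 3 (Pop 3 ;; Push 2 true)
  (fun i => St io (odd n.+1 :: true :: o) (unary i) (unary (h - i)) [::] a x
      p p' t t' s0 s1)
  h 6 isT.
rewrite subn0 subnn; apply=> // i lti; first by rewrite -subnSK.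
apply: (@does_le _ _ _ _ (1 + 3).+1) => //.
by rewrite -subnSK //; apply: does_seq; [exact: does_pop | exact: does_push].
Qed.

(** Moving a stack reverses it; [also] runs once per symbol, for instance to count them. *)
Definition Move (r q : nat) (also : cmd) : cmd :=
  While r (Case r Skip (Pop r ;; Push q false ;; also)
                       (Pop r ;; Push q true ;; also)).

Lemma does_move (G : seq bool -> seq bool -> nat -> seq (seq bool)) r q also
    s z i cost :
  r <= 12 -> q <= 12 ->
  (forall x y i, nth [::] (G x y i) r = x /\ nth [::] (G x y i) q = y) ->
  (forall x y i z, set_nth [::] (G x y i) r z = G z y i /\
                   set_nth [::] (G x y i) q z = G x z i) ->
  (forall x y i, does also (G x y i) (G x y i.+1) cost) ->
  does (Move r q also) (G s z i) (G [::] (catrev s z) (i + size s))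
    (size s * (cost + 8)).+1.
Proof.
move=> ler leq Gn Gs Hx; elim: s z i => [|b s IH] z i /=.
  by rewrite addn0; apply: does_while_nil => //; case: (Gn [::] z i).
apply: (@does_le _ _ _ _ ((1 + (3 + cost).+1).+1.+1 +
    (size s * (cost + 8)).+1).+1).
  by lia.
rewrite -addSnnS; apply: does_while_cons (IH (b :: z) i.+1) => //.
  by case: (Gn (b :: s) z i) => ->.
have step : does (Pop r ;; Push q b ;; also) (G (b :: s) z i)
    (G s (b :: z) i.+1)
    (1 + (3 + cost).+1).+1.
  apply: does_seq.
    have := does_pop (G (b :: s) z i) ler.
    by rewrite (Gn _ _ _).1 (Gs _ _ _ _).1; apply.
  apply: does_seq; last exact: Hx.
  by have := does_push b (G s z i) leq; rewrite (Gn _ _ _).2 (Gs _ _ _ _).2;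
      apply.
by apply: does_case => // [|s'|s']; rewrite (Gn _ _ _).1 => // -[<- _].
Qed.

Lemma does_iter c (inv : nat -> seq (seq bool)) n cost :
  (forall i, i < n -> does c (inv i) (inv i.+1) cost) ->
  does (Seqs (nseq n c)) (inv 0) (inv n) (n * cost.+1).+1.
Proof.
elim: n inv => [|n IH] inv H /=; first exact: does_skip.
apply: (@does_le _ _ _ _ (cost + (n * cost.+1).+1).+1); first by rewrite mulSn;
    lia.
apply: does_seq (H 0 isT) _.
by apply: (IH (fun i => inv i.+1)) => i lti; exact: H.
Qed.

Lemma size_flatten_bits (f : bool -> seq bool) r :
  size (flatten (map f r)) <= size r * (size (f true) + size (f false)).
Proof.
elim: r => //= b r IH; rewrite size_cat mulSn leq_add //.
by case: b; rewrite ?leq_addr ?leq_addl.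
Qed.

(** * Writing out the vectors *)

Section EmitMatrix.
Variables (N : tm bool) (e : nat).

(** A pure power is computed by iterated multiplication in unary, and this one dominates
    [poly_bound e n]. *)
Definition grid (n : nat) : nat := (n + e.+1) ^ e.+1.

Definition entry (b : bool) : rat :=
  (if b then ((2 * half_scale N)%:R)^-1 else 0)%R.

Definition enc_bit (b : bool) : seq bool := enc_rat (entry b).

Definition enc_bits (r : seq bool) : seq bool := flatten (map enc_bit r).

Definition block_bound : nat :=
  #|slot N| * (size (enc_bit true) + size (enc_bit false)).

Lemma size_enc_bits r : size r = #|slot N| -> size (enc_bits r) <= block_bound.
Proof. by rewrite /block_bound => <-; exact: size_flatten_bits. Qed.

Lemma enc_bits_flatten ss : enc_bits (flatten ss) = flatten (map enc_bits ss).
Proof.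
by elim: ss => //= s ss IH; rewrite /enc_bits map_cat flatten_cat -IH.
Qed.

Definition EmitRow (fl : flags) (v : window N) : cmd :=
  Rep 11 6 (Emit 1 (enc_bits (zero_block N))) ;;
  Emit 1 (enc_bits (block (up_bit fl v))) ;;
  Rep 5 6 (Emit 1 (enc_bits (zero_block N))) ;;
  Emit 1 (enc_bits (block (own_bit fl v))) ;;
  Emit 1 (enc_bits (block (right_bit fl v))) ;;
  Rep 12 6 (Emit 1 (enc_bits (zero_block N))).

(** The windows depend on the fixed machine [N] only, so the nonzero blocks are hard-coded in the
    program; the input only determines the flags and the numbers of zero blocks, held in registers
    5, 11 and 12. *)
Definition EmitSite (fl : flags) : cmd :=
  Seqs (map (EmitRow fl) (row_values N)) ;; Push 11 true ;; Pop 12.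

(* At time 0 the input symbol of the site is the top of the register 0. *)
Definition EmitFirst (edge : bool) : cmd :=
  Case 0 (EmitSite (Flags true false edge None))
         (Pop 0 ;; EmitSite (Flags true false edge (Some false)))
         (Pop 0 ;; EmitSite (Flags true false edge (Some true))).

Definition EmitLine (last : bool) : cmd :=
  EmitSite (Flags false last true None) ;;
  Rep 7 8 (EmitSite (Flags false last false None)).

(** The [L.+2] lines are the one that consumes the input, [L] identical ones, and the one that tests
    acceptance; each consists of an edge site and [L] others. *)
Definition EmitMatrix : cmd :=
  (EmitFirst true ;; Rep 7 8 (EmitFirst false)) ;;
  Rep 9 10 (EmitLine false) ;;
  EmitLine true.

Section Matrix.
Variables (L : nat) (w : seq bool) (t t' : seq bool).

Definition row_cost : nat := (sites L + L) * (block_bound * 4 + 14) +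
  block_bound * 12 + 17.

Lemma does_row fl v s io o p p' : s < sites L ->
  does (EmitRow fl v)
    (St io o [::] [::] [::] (unary L) [::] p p' t t'
        (unary s) (unary (sites L - s.+1)))
    (St io (catrev (enc_bits (row L s fl v)) o) [::] [::] [::] (unary L) [::]
        p p' t t' (unary s) (unary (sites L - s.+1)))
    row_cost.
Proof.
move=> lts; rewrite /row enc_bits_flatten /row_blocks map_cat map_nseq /=.
rewrite map_cat map_nseq /= map_nseq flatten_cat /= flatten_cat /= !catrev_catl.
set z := enc_bits (zero_block N).
have lez : size z <= block_bound by apply: size_enc_bits; rewrite size_nseq.
have lef (f : slot N -> bool) : size (enc_bits (block f)) <= block_bound.
  by apply: size_enc_bits; rewrite size_block.
have := (lef (up_bit fl v), lef (own_bit fl v), lef (right_bit fl v)).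
rewrite /EmitRow -/z; set u := enc_bits _; set b := enc_bits _; set r :=
    enc_bits _.
case=> [[leu leb] ler].
pose S o := St io o [::] [::] [::] (unary L) [::] p p' t t'
        (unary s) (unary (sites L - s.+1)).
apply: (@does_le _ _ _ _ (s * (size z * 4 + 14) + 3 + ((size u * 4).+1 +
  (L * (size z * 4 + 14) + 3 + ((size b * 4).+1 + ((size r * 4).+1 +
   ((sites L - s.+1) * (size z * 4 + 14) + 3)).+1).+1).+1).+1).+1).
  rewrite /row_cost; set k := size z * 4 + 14.
  have : (s + L + (sites L - s.+1)) * k <= (sites L + L) *
      (block_bound * 4 + 14).
    by apply: leq_mul; rewrite /k; lia.
  lia.
have emit str o1 : does (Emit 1 str) (S o1) (S (catrev str o1))
    (size str * 4).+1.
  exact: (@does_emit _ S).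
apply: does_seq.
  exact: (@does_rep_emit (fun x y o => St io o [::] [::] [::] (unary L) y p p'
      t t' x _)).
apply: does_seq; first exact: emit.
apply: does_seq.
  exact: (@does_rep_emit (fun x y o => St io o [::] [::] [::] x y p p'
      t t' _ _) 5 6).
apply: does_seq; first exact: emit.
apply: does_seq; first exact: emit.
exact: (@does_rep_emit (fun x y o => St io o [::] [::] [::] _ y p p' t t' _ x)
    12 6).
Qed.

Definition site_str (s : nat) : seq bool :=
  enc_bits (flatten (site_rows N w L s)).

Definition site_state io p p' o s : seq (seq bool) :=
  St io (catrev (flatten (map site_str (iota 0 s))) o) [::] [::] [::] (unary L)
     [::] p p' t t' (unary s) (unary (sites L - s.+1)).

Definition site_cost : nat := size (row_values N) * row_cost.+1 + 7.

Lemma does_site fl s io p p' o : s < sites L -> fl = site_flags w L s ->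
  does (EmitSite fl) (site_state io p p' o s) (site_state io p p' o s.+1)
      site_cost.
Proof.
move=> lts flE.
apply: (@does_le _ _ _ _ ((size (row_values N) * row_cost.+1).+1 +
    (3 + 1).+1).+1).
  by rewrite /site_cost; lia.
have strE : catrev (flatten (map site_str (iota 0 s.+1))) o =
    catrev (flatten (map (fun v => enc_bits (row L s fl v)) (row_values N)))
      (catrev (flatten (map site_str (iota 0 s))) o).
  rewrite -catrev_catl -[in LHS](addn1 s) iotaD map_cat flatten_cat /= cats0
      flE.
  by rewrite add0n {2}/site_str enc_bits_flatten /site_rows -map_comp.
rewrite {2}/site_state strE.
apply: does_seq.
  apply: (@does_seqs 12 _ (EmitRow fl) (fun v => enc_bits (row L s fl v)) _
    (fun o => St io o [::] [::] [::] (unary L) [::] p p' t t' (unary s)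
                 (unary (sites L - s.+1)))) => v o'; exact: does_row.
apply: does_seq; first exact: does_push.
(* This includes the last site, where both sides are empty and [Pop] leaves the register empty. *)
have -> : unary (sites L - s.+2) = behead (unary (sites L - s.+1)).
  by rewrite subnS; case: (sites L - s.+1).
exact: does_pop.
Qed.

End Matrix.

Lemma site_flagsE L w k p : p <= L ->
  site_flags w L (k * L.+1 + p) = flags_at w L k p.
Proof.
move=> lep; rewrite /site_flags divnMDl // modnMDl.
by rewrite divn_small // modn_small // addn0.
Qed.

Lemma does_first L w t t' edge p x x' o : p <= L -> edge = (p == 0) ->
  does (EmitFirst edge) (site_state L w t t' (drop p w) x x' o p)
    (site_state L w t t' (drop p.+1 w) x x' o p.+1) (site_cost L + 3).
Proof.
move=> lep ->; have ltp : p < sites L by rewrite /sites; nia.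
have flE : site_flags w L p = Flags true false (p == 0)
    (nth None (map Some w) p).
  by have := site_flagsE w 0 lep; rewrite mul0n add0n => ->.
rewrite addnS; apply: does_case => // [|s|s]; rewrite [nth _ _ _]/= => dropE.
- have lew : size w <= p by rewrite -subn_eq0 -size_drop dropE.
  rewrite dropE (drop_oversize (leqW lew)); apply: does_le; last first.
    apply: does_site => //; by rewrite flE nth_default ?size_map.
  by rewrite leq_addr.
- have ltw : p < size w by rewrite -subn_gt0 -size_drop dropE.
  move: dropE; rewrite (drop_nth false) // => -[wp _].
  apply: (@does_le _ _ _ _ (1 + site_cost L).+1); first by lia.
  apply: does_seq; first exact: does_pop.
  by apply: does_site => //; rewrite flE (nth_map false) // wp.
have ltw : p < size w by rewrite -subn_gt0 -size_drop dropE.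
move: dropE; rewrite (drop_nth false) // => -[wp _].
apply: (@does_le _ _ _ _ (1 + site_cost L).+1); first by lia.
  apply: does_seq; first exact: does_pop.
by apply: does_site => //; rewrite flE (nth_map false) // wp.
Qed.

Definition line_cost L : nat := L * (site_cost L + 16) + site_cost L + 7.

Lemma does_first_line L w t t' o :
  does (EmitFirst true ;; Rep 7 8 (EmitFirst false))
    (site_state L w t t' w (unary L) [::] o 0)
    (site_state L w t t' (drop L.+1 w) (unary L) [::] o L.+1) (line_cost L).
Proof.
apply: (@does_le _ _ _ _ (site_cost L + 3 +
    (L * (site_cost L + 3 + 13) + 3)).+1).
  by rewrite /line_cost; lia.
apply: does_seq.
  by have := @does_first L w t t' true 0 (unary L) [::] o; rewrite drop0; apply.
apply: (@does_rep 12 (fun x y i => site_state L w t t' (drop i.+1 w) x y o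
    i.+1) 7 8) => //.
by move=> i lti; exact: does_first.
Qed.

Lemma does_line L w t t' last k io o : 0 < k <= L.+1 -> last = (k == L.+1) ->
  does (EmitLine last)
    (site_state L w t t' io (unary L) [::] o (k * L.+1))
    (site_state L w t t' io (unary L) [::] o (k.+1 * L.+1)) (line_cost L).
Proof.
move=> /andP[k0 lek] ->.
have ltp p : p <= L -> k * L.+1 + p < sites L by move=> lep; rewrite /sites;
    nia.
have flE p : p <= L -> site_flags w L (k * L.+1 + p) =
    Flags false (k == L.+1) (p == 0) None.
  by move=> lep; rewrite site_flagsE // /flags_at (gtn_eqF k0).
apply: (@does_le _ _ _ _ (site_cost L + (L * (site_cost L + 13) + 3)).+1).
  by rewrite /line_cost; lia.
apply: does_seq.
  by apply: does_site; rewrite -[k * L.+1]addn0 ?flE ?ltp.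
have := @does_rep 12 (fun x y i => site_state L w t t' io x y o
    (k * L.+1 + i.+1)) 7 8
  (EmitSite (Flags false (k == L.+1) false None)) L (site_cost L).
rewrite addn1 (_ : k * L.+1 + L.+1 = k.+1 * L.+1); last by rewrite mulSn addnC.
apply=> // i lti; rewrite [k * L.+1 + i.+2]addnS.
by apply: does_site; rewrite ?flE ?ltp.
Qed.

Definition matrix_cost L : nat := L.+2 * (line_cost L + 20) + 20.

Lemma does_matrix L w o : size w <= L.+1 ->
  does EmitMatrix (site_state L w (unary L) [::] w (unary L) [::] o 0)
    (site_state L w (unary L) [::] [::] (unary L) [::] o (sites L))
      (matrix_cost L).
Proof.
move=> lew.
apply: (@does_le _ _ _ _ (line_cost L + (L * (line_cost L + 13) + 3 + line_cost
    L).+1).+1).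
  by rewrite /matrix_cost; nia.
apply: does_seq; first exact: does_first_line.
rewrite drop_oversize //; apply: does_seq.
  have := @does_rep 12 (fun x y i => site_state L w x y [::] (unary L) [::] o
      (i.+1 * L.+1))
    9 10 (EmitLine false) L (line_cost L).
  rewrite mul1n; apply=> // i lti; apply: does_line; first by lia.
  by rewrite eqSS ltn_eqF.
by rewrite /sites; apply: does_line; rewrite ?leqnn ?eqxx.
Qed.

End EmitMatrix.

Lemma size_flatten_le (T : eqType) (U : Type) (f : T -> seq U) (xs : seq T) B :
  (forall x, x \in xs -> size (f x) <= B) ->
  size (flatten (map f xs)) <= size xs * B.
Proof.
elim: xs => //= x xs IH H; rewrite size_cat mulSn leq_add ?H ?mem_head //.
by apply: IH => y yin; rewrite H // inE yin orbT.
Qed.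

(** * The complete program and its cost *)

Section Reduction.
Variables (N : tm bool) (e : nat).

(** The second move undoes the reversal by the first, which also writes the length of the input to
    register 3. *)
Definition ReadInput : cmd := Move 0 2 (Push 3 true) ;; Move 2 0 Skip.

Lemma does_read_input w :
  does ReadInput (St w [::] [::] [::] [::] [::] [::] [::] [::] [::] [::] [::]
      [::])
    (St w [::] [::] (unary (size w)) [::] [::] [::] [::] [::] [::] [::] [::]
      [::])
    (size w * 20 + 3).
Proof.
apply: (@does_le _ _ _ _ ((size w * 11).+1 + (size w * 9).+1).+1); first by lia.
apply: does_seq.
  apply: (@does_move (fun x y i => St x [::] y
      (unary i) [::] [::] [::] [::] [::] [::] [::] [::] [::]) 0 2 _ w [::] 0 3)
        => // *.
  exact: does_push.
rewrite add0n.
have := @does_move (fun x y i => St y [::] x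
    (unary (size w)) [::] [::] [::] [::] [::] [::] [::] [::] [::])
  2 0 Skip (catrev w [::]) [::] 0 1.
rewrite !catrevE !cats0 revK size_rev; apply=> // *; exact: does_skip.
Qed.

Definition Multiply : cmd :=
  While 5 (Pop 5 ;; Rep 3 4 (Emit 2 [:: true])) ;; Move 2 5 Skip.

Lemma does_multiply w m n :
  does Multiply
    (St w [::] [::] (unary m) [::] (unary n) [::] [::] [::] [::] [::] [::] [::])
    (St w [::] [::] (unary m) [::] (unary (n *
      m)) [::] [::] [::] [::] [::] [::] [::])
    (n * m * 30 + n * 10 + 5).
Proof.
apply: (@does_le _ _ _ _ ((n * (1 + (m * (1 * 4 + 14) + 3)).+1.+1).+1 +
                         (n * m * 9).+1).+1); first by nia.
apply: does_seq.
  have := @does_loop 12 5 (Pop 5 ;; Rep 3 4 (Emit 2 [:: true]))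
    (fun i => St w [::] (unary (i * m)) (unary m) [::]
      (unary (n - i)) [::] [::] [::] [::] [::] [::] [::]) n.
  rewrite subn0 subnn; apply=> // i lti; first by rewrite -subnSK.
  rewrite -subnSK //; apply: does_seq; first exact: does_pop.
  have := @does_rep_emit (fun x y o => St w [::] o x y
      (unary (n - i.+1)) [::] [::] [::] [::] [::] [::] [::])
    3 4 2 (unary 1) m (unary (i * m)).
  by rewrite flatten_nseq_unary catrev_unary muln1 -mulSn; apply.
have := @does_move (fun x y i => St w [::] x (unary m) [::]
    y [::] [::] [::] [::] [::] [::] [::])
  2 5 Skip (unary (n * m)) (unary 0) 0 1.
rewrite catrev_unary addn0 size_nseq; apply=> // *; exact: does_skip.
Qed.

(** The side [L] is the power of [n + e.+1] accumulated in register 5. It is copied because nested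
    loops need separate counters; register 12 receives [sites L = L * (L + 3) + 2]. *)
Definition Prepare : cmd :=
  ReadInput ;; Emit 3 (unary e.+1) ;; Push 5 true ;;
  Seqs (nseq e.+1 Multiply) ;;
  While 3 (Pop 3) ;;
  Rep 5 6 (Push 7 true ;; Push 9 true) ;;
  Rep 5 6 (Rep 7 8 (Emit 12 (unary 1)) ;; Emit 12 (unary 3)) ;;
  Emit 12 (unary 2).

Definition start_of (w o : seq bool) (L : nat) : seq (seq bool) :=
  St w o [::] [::] [::] (unary L) [::] (unary L) [::] (unary L) [::] [::]
      (unary (sites L)).

Definition prepare_cost n : nat :=
  let L := grid e n in
  n * 20 + 3 + e.+1 * 4 + 1 + 3 + (e.+1 * (L * 30 + L * 10 + 6) + 1) +
  ((n + e.+1) * 2 + 1) + (L * 20 + 3) + (L * (L * 18 + 3 + 13 + 14) + 3) + 9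
      + 7.

Lemma does_prepare w :
  does Prepare (w :: nseq 12 [::]) (start_of w [::] (grid e (size w)))
    (prepare_cost (size w)).
Proof.
set L := grid e (size w).
apply: (@does_le _ _ _ _ (size w * 20 + 3 + ((size (unary e.+1) * 4).+1 + (3 +
  ((e.+1 * (L * 30 + L * 10 + 5).+1).+1 + (((e.+1 + size w) * 2).+1 +
   (L * ((3 + 3).+1 + 13) + 3 + (L * ((L * (size (unary 1) * 4 + 14) + 3 +
       (size (unary 3) * 4).+1).+1 + 13) + 3 +
    (size (unary 2) * 4).+1).+1).+1).+1).+1).+1).+1).+1).
  by rewrite /prepare_cost -/L !size_nseq; lia.
apply: does_seq; first exact: does_read_input.
apply: does_seq.
  exact: (@does_emit 12 (fun o => St w [::] [::]
      o [::] [::] [::] [::] [::] [::] [::] [::] [::])).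
rewrite catrev_unary; apply: does_seq; first exact: does_push.
set l := e.+1 + size w.
apply: does_seq.
  apply: (@does_iter Multiply (fun i => St w [::] [::] (unary l) [::]
      (unary (l ^ i)) [::] [::] [::] [::] [::] [::] [::])) => i lti.
  apply: does_le; last by rewrite expnSr; exact: does_multiply.
  have l0 : 0 < l by rewrite /l addSn.
  have le1 : l ^ i * l <= L by rewrite /L /grid -expnSr addnC leq_pexp2l.
  have le2 : l ^ i <= L by rewrite (leq_trans _ le1) // leq_pmulr.
  by lia.
have -> : l ^ e.+1 = L by rewrite /L /grid addnC.
apply: does_seq.
  have := @does_loop 12 3 (Pop 3) (fun i =>
      St w [::] [::] (unary (l - i)) [::] (unary
        L) [::] [::] [::] [::] [::] [::] [::]) l 1.
  rewrite subn0 subnn; apply=> // i lti; first by rewrite -subnSK.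
  by rewrite -[l - i]subnSK //; exact: does_pop.
apply: does_seq.
  apply: (@does_rep 12 (fun x y i => St w [::] [::] [::] [::] x y
      (unary i) [::] (unary i) [::] [::] [::]) 5 6) => //.
  by move=> i lti; apply: does_seq; exact: does_push.
apply: does_seq.
  apply: (@does_rep 12 (fun x y i => St w [::] [::] [::] [::] x y
      (unary L) [::] (unary L) [::] [::] (unary (i * (L + 3)))) 5 6) => //.
  move=> i lti; apply: does_seq.
    exact: (@does_rep_emit (fun x y o => St w [::] [::] [::] [::]
      (unary (L - i.+1)) (unary i.+1) x y (unary L) [::] [::] o) 7 8 12).
  rewrite flatten_nseq_unary catrev_unary.
  have := @does_emit 12 (fun o => St w [::] [::] [::] [::] (unary (L - i.+1))
      (unary i.+1) (unary L) [::] (unary L) [::] [::] o)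
    12 (unary 3) (unary (L * 1 + i * (L + 3))).
  by rewrite catrev_unary (_ : 3 + _ = i.+1 * (L + 3)) ?muln1;
      [apply | rewrite mulSn; lia].
have := @does_emit 12 (fun o => St w [::] [::] [::] [::] (unary L) [::]
    (unary L) [::] (unary L) [::] [::] o)
    12 (unary 2) (unary (L * (L + 3))).
rewrite catrev_unary (_ : 2 + _ = sites L); last by rewrite /sites; nia.
by apply.
Qed.

(** Every number of the header, the threshold included, is affine in [sites L] (register 12) and [L]
    (register 5), with coefficients depending on [N] only. *)
Definition EmitAffine (p q r : nat) : cmd :=
  Rep 12 6 (Emit 2 (unary p)) ;; Rep 5 6 (Emit 2 (unary q)) ;;
  Emit 2 (unary r) ;; EncNat.

Definition affine_cost (p q r L : nat) : nat :=
  let m := sites L * p + L * q + r in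
  sites L * (p * 4 + 14) + 3 + (L * (q * 4 + 14) + 3) + (r * 4 + 1) +
  (m * (m * 15 + 40) + 10) + 3.

Lemma does_affine p q r w o L :
  does (EmitAffine p q r) (start_of w o L)
    (start_of w (catrev (enc_nat (sites L * p + L * q + r)) o) L)
      (affine_cost p q r L).
Proof.
set m := sites L * p + L * q + r.
apply: (@does_le _ _ _ _ (sites L * (size (unary p) * 4 + 14) + 3 +
  (L * (size (unary q) * 4 + 14) + 3 + ((size (unary r) * 4).+1 +
   (m * (m * 15 + 40) + 10)).+1).+1).+1).
  by rewrite /affine_cost -/m !size_nseq; lia.
apply: does_seq.
  exact: (@does_rep_emit (fun x y u => St w o u [::] [::] (unary L) y
      (unary L) [::] (unary L) [::] [::] x)
    12 6 2 (unary p) (sites L) (unary 0)).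
rewrite flatten_nseq_unary catrev_unary addn0.
apply: does_seq.
  exact: (@does_rep_emit (fun x y u => St w o u [::] [::] x y (unary L) [::]
      (unary L) [::] [::] (unary (sites L)))
    5 6 2).
rewrite flatten_nseq_unary catrev_unary.
apply: does_seq.
  exact: (@does_emit 12 (fun u => St w o u [::] [::] (unary L) [::]
      (unary L) [::] (unary L) [::] [::] (unary (sites L)))).
rewrite catrev_unary (_ : r + _ = m); last by rewrite /m; lia.
exact: does_enc_nat.
Qed.

Definition num_vectors L := sites L * size (row_values N).
Definition dimension L := (sites L + L + 2) * #|slot N|.
(** The value [(d - k) / lambda + k] of an orthogonal design at [lambda = 1/2]. *)
Definition threshold L := 2 * dimension L - sites L.

Definition half_code : seq bool := enc_rat (2^-1)%R.

Definition reduction (w : seq bool) : seq bool :=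
  let L := grid e (size w) in
  enc_nat (num_vectors L) ++ enc_nat (dimension L) ++ enc_nat (sites L) ++
  half_code ++ (false :: enc_nat (threshold L)) ++ enc_int 1 ++
  flatten (map (site_str N L w) (iota 0 (sites L))).

(** [Pop 12] turns the number of sites into the number of those after site 0. The matrix consumes
    the input, so register 0 is empty when the last move reverses the output into it. *)
Definition Reduce : cmd :=
  Prepare ;;
  EmitAffine (size (row_values N)) 0 0 ;;
  EmitAffine #|slot N| #|slot N| (2 * #|slot N|) ;;
  EmitAffine 1 0 0 ;;
  Emit 1 half_code ;; Emit 1 [:: false] ;;
  EmitAffine (2 * #|slot N| - 1) (2 * #|slot N|) (4 * #|slot N|) ;;
  Emit 1 (enc_int 1) ;;
  Pop 12 ;; EmitMatrix N ;; Move 1 0 Skip.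

Definition output_bound (L : nat) : nat :=
  (2 * num_vectors L + 1) + (2 * dimension L + 1) + (2 * sites L + 1) +
  size half_code + (2 * threshold L + 2) + size (enc_int 1) +
  sites L * (size (row_values N) * dimension L *
             (size (enc_bit N true) + size (enc_bit N false))).

Lemma size_enc_nat n : size (enc_nat n) <= 2 * n + 1.
Proof.
rewrite /enc_nat size_cat leq_add2r.
apply: leq_trans (size_flatten_le (B := 2) _) _ => //.
rewrite mulnC leq_mul2l /nat_bits size_map size_iota /=.
by apply: up_log_min => //; exact: ltn_expl.
Qed.

Lemma size_reduction w : size (reduction w) <= output_bound (grid e (size w)).
Proof.
rewrite /reduction /output_bound; set L := grid e _.
set o := flatten _; have : size o <= sites L *
    (size (row_values N) * dimension L *
    (size (enc_bit N true) + size (enc_bit N false))); last first.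
  have := size_enc_nat (num_vectors L); have := size_enc_nat (dimension L).
  have := size_enc_nat (sites L); have := size_enc_nat (threshold L).
  have sizeE (a b c h t u v : seq bool) :
      size (a ++ b ++ c ++ h ++ (false :: t) ++ u ++ v) =
      size a + size b + size c + size h + (size t).+1 + size u + size v.
    by rewrite !size_cat /=; lia.
  rewrite sizeE; lia.
rewrite -{1}(size_iota 0 (sites L)); apply: size_flatten_le => s.
rewrite mem_iota add0n => /andP[_ lts].
rewrite /site_str /enc_bits (leq_trans (size_flatten_bits _ _)) // leq_mul2r.
rewrite (@size_flatten_blocks _ (dimension L)) /site_rows ?size_map ?leqnn
    ?orbT //.
by rewrite all_map; apply/allP => v _ /=; rewrite size_row.
Qed.

Definition reduce_cost (n : nat) : nat :=
  let L := grid e n in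
  prepare_cost n + affine_cost (size (row_values N)) 0 0 L +
  affine_cost #|slot N| #|slot N| (2 * #|slot N|) L +
  affine_cost 1 0 0 L + size half_code * 4 + 1 + 5 +
  affine_cost (2 * #|slot N| - 1) (2 * #|slot N|) (4 * #|slot N|) L +
  size (enc_int 1) * 4 + 1 + 1 + matrix_cost N L + output_bound L * 9 + 20.

Lemma leq_grid n : n <= grid e n.
Proof.
rewrite /grid expnS; apply: leq_trans (leq_addr e.+1 n) _.
by rewrite leq_pmulr // expn_gt0 addnS.
Qed.

Lemma does_reduce w : exists2 st,
  does Reduce (w :: nseq 12 [::]) st (reduce_cost (size w)) &
  nth [::] st 0 = reduction w.
Proof.
set L := grid e (size w).
exists (St (reduction w) [::] [::] [::] [::] (unary L) [::] (unary L) [::]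
   (unary L) [::] (unary (sites L)) [::]); last by [].
apply: (@does_le _ _ _ _ (prepare_cost (size w) +
 (affine_cost (size (row_values N)) 0 0 L +
 (affine_cost #|slot N| #|slot N| (2 * #|slot N|) L +
 (affine_cost 1 0 0 L + ((size half_code * 4).+1 + (5 +
 (affine_cost (2 * #|slot N| - 1) (2 * #|slot N|) (4 * #|slot N|) L +
 ((size (enc_int 1) * 4).+1 + (1 + (matrix_cost N L +
  (size (reduction w) * 9).+1).+1).+1).+1).+1).+1).+1).+1).+1).+1).+1).
  by have := size_reduction w; rewrite /reduce_cost -/L; lia.
have emit str o : does (Emit 1 str) (start_of w o L)
    (start_of w (catrev str o) L) (size str * 4).+1.
  exact: (@does_emit 12 (fun o => start_of w o L)).
apply: does_seq; first exact: does_prepare.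
apply: does_seq; first exact: does_affine.
apply: does_seq; first exact: does_affine.
apply: does_seq; first exact: does_affine.
apply: does_seq; first exact: emit.
apply: does_seq; first exact: emit.
apply: does_seq; first exact: does_affine.
apply: does_seq; first exact: emit.
set o := catrev (enc_int 1) _.
apply: (@does_seq _ _ _ _ (site_state N L w (unary L) [::] w (unary L) [::]
    o 0)).
  rewrite /site_state (_ : unary (sites L - 1) = behead (unary (sites L))).
    exact: does_pop.
  by rewrite subn1; case: (sites L).
apply: does_seq.
  exact: (@does_matrix N L w o (leq_trans (leq_grid _) (leqnSn _))).
rewrite /site_state subnS subnn.
set o' := catrev _ o.
have o'E : o' = catrev (reduction w) [::].
  have catE (a b c h y u z : seq bool) :
      catrev (a ++ b ++ c ++ h ++ (false :: y) ++ u ++ z) [::] =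
      catrev z (catrev u (catrev y (catrev [:: false] (catrev h
        (catrev c (catrev b (catrev a [::]))))))).
    by rewrite !catrev_catl.
  rewrite /reduction catE -/L /o' /o.
  have C0 := slot_gt0 N.
  have -> : num_vectors L = sites L * size (row_values N) + L * 0 + 0.
    by rewrite /num_vectors muln0 !addn0.
  have -> : dimension L = sites L * #|slot N| + L * #|slot N| + 2 * #|slot N|.
    by rewrite /dimension !mulnDl.
  have -> : threshold L =
      sites L * (2 * #|slot N| - 1) + L * (2 * #|slot N|) + 4 * #|slot N|.
    rewrite /threshold /dimension; move: (sites L) #|slot N| C0 => n C C0.
    by nia.
  by rewrite {9}(_ : sites L = sites L * 1 + L * 0 + 0) // muln1 muln0 !addn0.
have := @does_move (fun x y i => St y x [::] [::] [::] (unary L) [::]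
    (unary L) [::]
   (unary L) [::] (unary (sites L)) [::]) 1 0 Skip
       (catrev (reduction w) [::]) [::] 0 1.
rewrite o'E !catrevE !cats0 revK size_rev; apply=> // *; exact: does_skip.
Qed.

Lemma reduce_cost_poly : poly_bounded reduce_cost.
Proof.
rewrite /reduce_cost /output_bound /prepare_cost /affine_cost /matrix_cost.
rewrite /line_cost /site_cost /row_cost /threshold /dimension /num_vectors.
have gridP : poly_bounded (grid e).
  by apply/poly_bounded_exp/poly_bounded_add;
    [exact: poly_bounded_id | exact: poly_bounded_const].
have sitesP : poly_bounded (fun n => sites (grid e n)).
  by apply: poly_bounded_mul; do !apply: poly_bounded_succ.
by repeat first [ exact: gridP | exact: sitesP | exact: poly_bounded_const
  | exact: poly_bounded_id | apply: poly_bounded_add | apply: poly_bounded_mul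
  | apply: poly_bounded_succ | apply: poly_bounded_sub ].
Qed.

Lemma reduction_polytime : polytime reduction.
Proof. exact: (does_polytime reduce_cost_poly does_reduce). Qed.

End Reduction.

(** * The reduced instance *)

Lemma flatten_flatten (T : Type) (ss : seq (seq (seq T))) :
  flatten (flatten ss) = flatten (map flatten ss).
Proof. by elim: ss => //= s ss IH; rewrite flatten_cat IH. Qed.

Lemma map_enum_ord (T : Type) n (f : nat -> T) :
  [seq f (nat_of_ord i) | i <- enum 'I_n] = [seq f i | i <- iota 0 n].
Proof. by rewrite -[iota 0 n]val_enum_ord -map_comp. Qed.

(** With [G = (n + c.+1) ^ c], both [n ^ c] and [c] are at most [G], so the bound is at most
    [c G + G], hence at most [(n + c.+1) G]. *)
Lemma poly_bound_grid c n : poly_bound c n <= grid c n.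
Proof.
rewrite /poly_bound /grid expnS.
have le1 : n ^ c <= (n + c.+1) ^ c by case: c => // c;
    rewrite leq_exp2r ?leq_addr.
have le2 : c <= (n + c.+1) ^ c.
  case: c {le1} => // c; apply: leq_trans (leqW (leq_addl n _)) _.
  by rewrite -addnS expnS leq_pmulr // expn_gt0 addnS.
by move: (n ^ c) ((n + c.+1) ^ c) le1 le2 => x y le1 le2; nia.
Qed.

Section Instance.
Variables (N : tm bool) (e : nat) (w : seq bool).
Let L := grid e (size w).

Definition reduced_instance : raod_instance :=
  @RaodInstance (num_vectors N L) (dimension N L) (sites L) (2^-1)%R
    ((threshold N L)%:Z%:~R)%R
    [ffun i : 'I_(num_vectors N L) =>
      (\col_(j < dimension N L) entry N (nth false (row_at N w L i) j))%R].

Lemma size_row_at i :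
  i < num_vectors N L -> size (row_at N w L i) = dimension N L.
Proof.
by move=> lti; rewrite row_at_val size_row // ltn_divLR ?size_row_values_gt0.
Qed.

Lemma enc_reduced_instance : enc_raod reduced_instance = reduction N e w.
Proof.
rewrite /enc_raod /reduction -/L [raod_n _]/= [raod_d _]/= [raod_k _]/=.
rewrite [raod_lambda _]/= [raod_threshold _]/= -/half_code.
congr (_ ++ _); congr (_ ++ _); congr (_ ++ _); congr (_ ++ _).
rewrite /enc_rat numq_int denq_int -[enc_int (threshold N L)]/(false :: enc_nat
    (threshold N L)).
rewrite -catA; congr (_ ++ _); congr (_ ++ _).
rewrite flatten_flatten -map_comp.
transitivity (flatten [seq enc_bits N (row_at N w L i) | i <- iota 0
    (num_vectors N L)]).
  rewrite -map_enum_ord; congr flatten; apply: eq_map => i /=.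
  rewrite /enc_bits; congr flatten.
  rewrite (eq_map (g := fun j : 'I_ _ => enc_bit N
      (nth false (row_at N w L i) j))).
    rewrite (map_enum_ord _ (fun j => enc_bit N
      (nth false (row_at N w L i) j))).
    rewrite -(size_row_at (ltn_ord i)) -{3}[row_at N w L i](mkseq_nth false).
    by rewrite -map_comp.
  by move=> j; rewrite ffunE mxE.
rewrite /num_vectors; set m := size _; elim: (sites L) => [|s IH] //.
rewrite mulSn addnC iotaD map_cat flatten_cat IH -[in RHS]addn1 iotaD map_cat.
rewrite flatten_cat; congr (_ ++ _); rewrite /= cats0 !add0n.
rewrite /site_str enc_bits_flatten; congr flatten.
rewrite -[site_rows N w L s](mkseq_nth [::]) /mkseq -map_comp.
rewrite [size (site_rows _ _ _ _)]size_map -/m -[s * m]addn0 iotaDl -map_comp.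
apply/eq_in_map => i; rewrite mem_iota add0n => /andP[_ lti] /=.
have m0 : 0 < m by exact: size_row_values_gt0.
by rewrite /row_at -/m divnMDl // modnMDl divn_small // modn_small // addn0.
Qed.

Lemma dimension_gt0 : 0 < dimension N L.
Proof. by rewrite /dimension muln_gt0 slot_gt0 addn2. Qed.

Lemma sites_gt0 : 0 < sites L. Proof. by []. Qed.

Lemma leq_sites_num_vectors : sites L <= num_vectors N L.
Proof. by rewrite leq_pmulr // size_row_values_gt0. Qed.

Lemma reduced_instance_valid : raod_valid reduced_instance.
Proof.
split; rewrite /= ?sites_gt0 ?leq_sites_num_vectors ?dimension_gt0 //.
rewrite /dimension /num_vectors size_row_values mulnA [sites L * _]mulnA.
have w0 : 0 < #|window N| by apply/card_gt0P; exists (default_window N).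
(* The factor 2 in [row_values] suffices because [L + 2 <= sites L]. *)
apply: leq_trans (leq_pmulr _ w0); rewrite leq_mul2r; apply/orP; right.
by rewrite /sites; nia.
Qed.

Section Value.
Variable R : realType.
Local Open Scope ring_scope.

Let vec (i : 'I_(num_vectors N L)) : 'cV[R]_(dimension N L) :=
  map_mx ratr (raod_vec reduced_instance i).
Let q : R := (2 * half_scale N)%:R.

Lemma reduced_vecE i j :
  vec i j 0 = if nth false (row_at N w L i) j then q^-1 else 0.
Proof.
rewrite /vec mxE ffunE mxE /entry; case: ifP => _; last exact: rmorph0.
by rewrite fmorphV rmorph_nat.
Qed.

Lemma dotc_vec i j : dotc (vec i) (vec j) = q^-1 ^+ 2 *
  (\sum_(l < dimension N L) (nth false (row_at N w L i) l &&
                             nth false (row_at N w L j) l))%N%:R.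
Proof.
rewrite /dotc natr_sum mulr_sumr; apply: eq_bigr => l _; rewrite !reduced_vecE.
by case: (nth _ _ _); case: (nth _ _ _); rewrite /= ?mulr1 ?mulr0 ?mul0r ?expr2.
Qed.

Lemma dotc_vec_count i :
  dotc (vec i) (vec i) = q^-1 ^+ 2 * (count id (row_at N w L i))%:R.
Proof.
rewrite dotc_vec; congr (_ * _%:R); rewrite -(size_row_at (ltn_ord i)).
rewrite -sum1_count (big_nth false) big_mkord [RHS]big_mkcond /=.
by apply: eq_bigr => l _; rewrite andbb; case: (nth _ _ _).
Qed.

Lemma scaled_full_norm : q^-1 ^+ 2 * (2 * half_scale N ^ 2)%:R = 1 - 2^-1.
Proof.
have q0 : (half_scale N)%:R != 0 :> R by rewrite pnatr_eq0 -lt0n half_scale_gt0.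
by rewrite /q !natrM; field.
Qed.

Lemma disjoint_rowsE (i j : 'I_(num_vectors N L)) :
  disjoint_rows (row_at N w L i) (row_at N w L j) <-> dotc (vec i) (vec j) = 0.
Proof.
have q0 : q^-1 ^+ 2 != 0.
  by rewrite expf_neq0 // invr_neq0 // pnatr_eq0 -lt0n muln_gt0 half_scale_gt0.
rewrite dotc_vec; split=> [dis|/eqP].
  by rewrite big1 ?mulr0 // => l _; rewrite (negbTE (dis l)).
rewrite mulf_eq0 (negbTE q0) pnatr_eq0 sum_nat_eq0 => /forallP H l.
have [ltl|lel] := ltnP l (dimension N L).
  by have := H (Ordinal ltl); rewrite /= eqb0.
by rewrite nth_default // size_row_at.
Qed.

Lemma thresholdE : ratr (raod_threshold reduced_instance) =
  ((dimension N L)%:R - (sites L)%:R) / 2^-1 + (sites L)%:R :> R.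
Proof.
rewrite /= ratr_int -pmulrn /threshold natrB; first by rewrite natrM; field.
rewrite /dimension; have := slot_gt0 N; nia.
Qed.

Lemma ratr_half : ratr 2^-1 = 2^-1 :> R.
Proof. by rewrite fmorphV rmorph_nat. Qed.

Lemma reduced_value :
  raod_value vec (ratr (raod_lambda reduced_instance)) (sites L)
    <= ratr (raod_threshold reduced_instance) <->
  exists v : nat -> nat -> window N, tableau w L v.
Proof.
rewrite thresholdE [raod_lambda _]/= ratr_half -rows_tableau.
have [[S0 S0k valS0] val_le] := raod_valueP vec 2^-1 leq_sites_num_vectors.
have half_gt0 : 0 < 2^-1 :> R by rewrite invr_gt0 ltr0n.
(* Admissible windows have squared norm 1/2 and the others 0, as the equality case of the convexity
   bound requires. *)
have norm_le i : dotc (vec i) (vec i) <= 1 - 2^-1.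
  rewrite dotc_vec_count row_at_val count_row; case: ifP => _.
    by rewrite scaled_full_norm.
  by rewrite mulr0 subr_ge0 invf_le1 ?ler1n ?ltr0n.
split=> [|[S [Sk norm dis]]].
  rewrite valS0 => le0.
  have [|norm orth] := raod_obj_le_orthogonal half_gt0 norm_le (S := S0).
    by rewrite S0k.
  exists S0; split=> // [i iS|i j iS jS ij].
    have := norm i iS; rewrite dotc_vec_count -scaled_full_norm => /mulfI.
    rewrite expf_neq0; last by rewrite invr_neq0 // pnatr_eq0 -lt0n muln_gt0
      half_scale_gt0.
    by move=> /(_ isT)/eqP; rewrite eqr_nat => /eqP.
  by apply/disjoint_rowsE; exact: orth.
apply: le_trans (val_le S Sk) _; rewrite (raod_obj_orthogonal half_gt0) ?Sk //.
  by move=> i iS; rewrite dotc_vec_count norm // scaled_full_norm.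
by move=> i j iS jS ij; apply/disjoint_rowsE; exact: dis.
Qed.
End Value.
End Instance.

Theorem theorem1 (R : realType) : NP_hard (RAOD R).
Proof.
move=> A [N [c H]]; exists (reduction N c); first exact: reduction_polytime.
move=> w; have [hlt ->] := H w.
rewrite (accepting_tableau hlt (poly_bound_grid c (size w)))
    -(reduced_value N c w R).
split=> [le|[I [_ E le]]].
  exists (reduced_instance N c w); split=> //;
    first exact: reduced_instance_valid.
  by rewrite enc_reduced_instance.
(* The output decodes in only one way, so the instance [I] witnessing membership is the reduced
   one. *)
move: E; rewrite -enc_reduced_instance => /enc_raod_inj E.
by move: le; rewrite -E.
Qed.
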